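(* For every integer $n\ge 1$ let $(X_{i,n},Y_{i,n})_{i=1,\dots,n}$ be i.i.d. with distribution $P_{X,Y,n}$ on $\mathbb{R}^2$ satisfying $\mathbb{E}[Y_{1,n}]>0$, $\mathbb{E}[X_{1,n}^2]<+\infty$ and $\mathbb{E}[Y_{1,n}^2]<+\infty$. Assume that (i) there are sequences of positive reals $(\gamma_{X,n})_{n\ge1}$, $(\gamma_{Y,n})_{n\ge1}$ and a (symmetric) positive definite $2\times2$ matrix $V$ such that the covariance matrix $\mathbb{V}[(\gamma_{X,n}X_{1,n},\gamma_{Y,n}Y_{1,n})]\to V$ as $n\to\infty$; (ii) $\sup_{n\ge1}\mathbb{E}\big[|\gamma_{X,n}X_{1,n}|^{4+\delta}+|\gamma_{Y,n}Y_{1,n}|^{4+\delta}\big]<+\infty$ for some $\delta>0$; (iii) $\mathbb{P}(\overline{Y}_n=0)\to0$ as $n\to\infty$; (iv) $\mathbb{P}(\overline{Y}_n^{(1)}=0)\to0$ as $n\to\infty$. Let $\mathrm{SNR}_n:=\mathbb{E}[Y_{1,n}]/\big(V_{2,2}^{1/2}n^{-1/2}\gamma_{Y,n}^{-1}\big)$. If $\mathrm{SNR}_n\to+\infty$, then for every $\alpha\in(0,1)$ the confidence interval $C_{n,\alpha}^{boot}$ is pointwise consistent at level $1-\alpha$, viz. $$\mathbb{P}\Big(C_{n,\alpha}^{boot}\ni\mathbb{E}[X_{1,n}]/\mathbb{E}[Y_{1,n}]\Big)\to1-\alpha\quad\text{as }n\to\infty.$$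
   Context: Notation: $\overline{U}_n:=n^{-1}\sum_{i=1}^nU_{i,n}$ is the empirical mean. Ratios with zero denominator are undefined. Bootstrap: given the sample $(X_{i,n},Y_{i,n})_{i=1,\dots,n}$, the bootstrapped sample $(X_{i,n}^{(1)},Y_{i,n}^{(1)})_{i=1,\dots,n}$ is obtained by $n$ i.i.d. draws (of pairs, with replacement, uniformly) from the initial sample. Set $\overline{X}_n^{(1)}:=n^{-1}\sum_{i=1}^nX_{i,n}^{(1)}$ and $\overline{Y}_n^{(1)}:=n^{-1}\sum_{i=1}^nY_{i,n}^{(1)}$. For $\tau\in(0,1)$, $q_\tau^{boot}$ denotes the quantile at level $\tau$ of the conditional distribution of $\overline{X}_n^{(1)}/\overline{Y}_n^{(1)}$ given the initial sample $(X_{i,n},Y_{i,n})_{i=1}^n$. The (Efron percentile bootstrap) interval is $C_{n,\alpha}^{boot}:=\big[q_{\alpha/2}^{boot},\,q_{1-\alpha/2}^{boot}\big]$. *)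

(* Defs.v *)
From HB Require Import structures.
From mathcomp Require Import all_boot all_order all_algebra.
From mathcomp Require Import all_classical all_reals all_analysis.

Set Implicit Arguments.
Unset Strict Implicit.
Unset Printing Implicit Defensive.

Import Order.TTheory GRing.Theory Num.Theory.
Import numFieldTopology.Exports numFieldNormedType.Exports.

Local Open Scope classical_set_scope.
Local Open Scope ring_scope.

Definition emp_mean (R : realType) (n : nat) (u : 'I_n -> R) : R :=
  n%:R^-1 * \sum_(i < n) u i.

(* Mutual independence is the product rule over the whole family: the rule for
   a subfamily follows by taking [A i := setT] outside of it. *)
Definition iid (d d' : measure_display) (W : measurableType d)
    (E : measurableType d') (R : realType) (P : probability W R)
    (mu : probability E R) (n : nat) (Z : 'I_n -> {RV P >-> E}) : Prop :=
  (forall (i : 'I_n) (A : set E), measurable A ->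
     distribution P (Z i) A = mu A) /\
  (forall A : 'I_n -> set E, (forall i, measurable (A i)) ->
     P (\bigcap_(i in [set: 'I_n]) (Z i @^-1` A i)) =
     (\prod_(i < n) P (Z i @^-1` A i))%E).

Definition sample (d d' : measure_display) (W : measurableType d)
    (E : measurableType d') (R : realType) (P : probability W R) (n : nat)
    (Z : 'I_n -> {RV P >-> E}) (w : W) : n.-tuple E :=
  [tuple Z i w | i < n].

(* [J i] is the index of the observation picked at the i-th draw. The product
   rule says both that [J 0, ..., J (n-1)] are i.i.d. uniform on ['I_n] (take
   [B := setT]) and that they are jointly independent of the sample [S]. *)
Definition uniform_draws (d d' : measure_display) (W : measurableType d)
    (E : measurableType d') (R : realType) (P : probability W R) (n : nat)
    (S : W -> E) (J : 'I_n -> W -> 'I_n) : Prop :=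
  (forall i j : 'I_n, measurable (J i @^-1` [set j])) /\
  (forall (B : set E) (f : 'I_n -> 'I_n), measurable B ->
     P (S @^-1` B `&` \bigcap_(i in [set: 'I_n]) (J i @^-1` [set f i])) =
     (P (S @^-1` B) * \prod_(i < n) (n%:R^-1)%:E)%E).

(* [k] is a (regular) conditional distribution of [T] given [S]. *)
Definition conditional_distribution (d d' : measure_display)
    (W : measurableType d) (E : measurableType d') (R : realType)
    (P : probability W R) (S : W -> E) (T : {RV P >-> R})
    (k : R.-pker E ~> R) : Prop :=
  forall (B : set E) (A : set R), measurable B -> measurable A ->
    P (S @^-1` B `&` T @^-1` A) = (\int[P]_(w in S @^-1` B) k (S w) A)%E.

Definition quantile (R : realType) (mu : set R -> \bar R) (tau : R) : R :=
  inf [set t : R | (tau%:E <= mu `]-oo, t]%classic)%E].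

(* Efron's percentile interval; [mu] is the conditional distribution of the
   bootstrapped ratio given the observed sample. *)
Definition percentile_interval (R : realType) (mu : set R -> \bar R)
    (alpha : R) : set R :=
  `[quantile mu (alpha / 2), quantile mu (1 - alpha / 2)]%classic.

Definition cov_matrix (d : measure_display) (W : measurableType d)
    (R : realType) (P : probability W R) (n : nat) (U : 'I_n -> W -> R) :
    'M[R]_n :=
  \matrix_(i < n, j < n) fine (covariance P (U i) (U j)).

Definition sym_posdef (R : realType) (n : nat) (V : 'M[R]_n) : Prop :=
  V^T = V /\ forall v : 'cV[R]_n, v != 0 -> 0 < (v^T *m V *m v) 0 0.

(* Main.v *)
(** The percentile interval contains [theta = EX / EY] exactly when the bootstrap
distribution function [F] satisfies [alpha / 2 <= F theta] and
[F (theta -) <= 1 - alpha / 2].  Up to the event that the bootstrapped mean of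
the [Y]'s is nonpositive, whose probability is [O(SNR ^ -2)] by Chebyshev's
inequality, the event "bootstrapped ratio [<= theta]" says that the bootstrapped
mean of the contrasts [D_i = c (X_i - theta Y_i)] is nonpositive.  These
contrasts are centered, and [c] makes their variance 1; positive definiteness of
the limit covariance bounds their fourth moments, whatever the size of [theta].

No Gaussian law is needed: both the sum of the [D_i] and its bootstrap version
are compared, by Lindeberg's replacement method, with the sum of [n] random signs
divided by [sqrt n], whose distribution function [G] is symmetric and has
increments [G (t + h) - G t <= h + 1 / sqrt n] by a bound on central binomial
coefficients.  Hence [F theta] is close to [G (- T)] where [T] is the normalized
sum of the [D_i], and [G (- T)] is close to uniform because [T] is itself close
to [G] in distribution. *)

Require Import Defs.
From HB Require Import structures.
From mathcomp Require Import all_boot all_order all_algebra.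
From mathcomp Require Import all_classical all_reals all_analysis.
From mathcomp Require Import measurable_realfun.
From mathcomp Require Import zify ring lra.

Set Implicit Arguments.
Unset Strict Implicit.
Unset Printing Implicit Defensive.

Import Order.TTheory GRing.Theory Num.Theory.
Import numFieldTopology.Exports numFieldNormedType.Exports.

Local Open Scope classical_set_scope.
Local Open Scope ring_scope.

(** * Test functions *)

(** The law of the observations changes with the sample size, so every comparison is an inequality
    at a fixed sample size with an explicit error; the asymptotic part only selects the smoothing
    width [h] and the tolerance [eps]. Atoms are the obstacle that shapes the statements: the
    resampled sums are discrete given the sample, and the contrasts may be discrete too. Upper
    bounds therefore concern events with [<=] and lower bounds events with [<], and [G] is inverted
    only approximately. The conditional law is known only through its integrals over events of the
    sample; it is compared, outside an event of small probability, with the explicit frequency over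
    all maps from draws to indices. Given the sample, the replacement argument is a finite
    computation with averaging operators whose error is random; fourth moments enter because the
    empirical mean of [D_i ^ 2] must concentrate around 1. *)

Section taylor_class.
Variable R : realType.
Implicit Types (M B s t h x : R) (g : R -> R).

(* [a] and [b] stand for [g'] and [g'' / 2]; asking no regularity of them makes
   the class evidently stable under averages of translates. *)
Definition taylor3 M B g := exists a b : R -> R,
  (forall x, `|b x| <= B) /\
  forall x h, `|g (x + h) - (g x + a x * h + b x * h ^+ 2)| <= M * `|h| ^+ 3.

(** One step of a random walk with increments [s] and [- s]: [iter n (sign_mean s) g x] is the
    expectation of [g] at [x] plus [s] times the sum of [n] random signs. *)
Definition sign_mean s g x := (g (x + s) + g (x - s)) / 2.

Lemma taylor3_sign_mean M B s g : taylor3 M B g -> taylor3 M B (sign_mean s g).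
Proof.
move=> [a [b [bB gT]]].
exists (sign_mean s a), (sign_mean s b); split=> [x|x h]; rewrite /sign_mean.
  have := bB (x + s); have := bB (x - s).
  rewrite !ler_norml; lra.
have := gT (x + s) h; have := gT (x - s) h.
rewrite !(addrAC x h) !ler_norml; lra.
Qed.

Lemma taylor3_iter_sign_mean M B s g k :
  taylor3 M B g -> taylor3 M B (iter k (sign_mean s) g).
Proof. by move=> gT; elim: k => //= k; exact: taylor3_sign_mean. Qed.

Definition pos_part x := Num.max x 0.

(** The second derivative [6 * pos_part x] is 6-Lipschitz, so the remainder is at most
    [6 * |h| ^ 3 / 6]. *)
Lemma pos_part_cube_taylor x h :
  `|pos_part (x + h) ^+ 3 -
    (pos_part x ^+ 3 + 3 * pos_part x ^+ 2 * h + 3 * pos_part x * h ^+ 2)|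
  <= `|h| ^+ 3.
Proof.
rewrite -normrX /pos_part.
case: (lerP x 0) => x0; case: (lerP (x + h) 0) => xh0.
- by rewrite !expr0n/= !(mulr0, mul0r, addr0, subr0, normr0).
- rewrite !expr0n/= !(mulr0, mul0r, addr0, subr0).
  rewrite !ger0_norm ?exprn_ge0//; [|lra|lra].
  by rewrite lerXn2r ?nnegrE; lra.
- rewrite expr0n/=.
  have -> : 0 - (x ^+ 3 + 3 * x ^+ 2 * h + 3 * x * h ^+ 2) =
    h ^+ 3 - (x + h) ^+ 3 by ring.
  have H1 : (- (x + h)) ^+ 3 <= (- h) ^+ 3 by rewrite lerXn2r ?nnegrE; lra.
  have H2 : 0 <= (- (x + h)) ^+ 3 by rewrite exprn_ge0//; lra.
  rewrite ler_norml.
  have -> : `|h ^+ 3| = (- h) ^+ 3.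
    by rewrite normrX ltr0_norm; lra.
  have e (y : R) : (- y) ^+ 3 = - y ^+ 3 by ring.
  by rewrite !e in H1 H2 *; apply/andP; split; lra.
- by rewrite -subr_ge0 le_eqVlt; apply/orP; left; apply/eqP;
    rewrite (_ : (x + h) ^+ 3 - _ = h ^+ 3) ?subrr//; ring.
Qed.

(* A third difference of truncated cubes; it decreases from 1 at 0 to 0 at 3. *)
Definition smooth_step x : R :=
  1 - (pos_part x ^+ 3 - 3 * pos_part (x - 1) ^+ 3
       + 3 * pos_part (x - 2) ^+ 3 - pos_part (x - 3) ^+ 3) / 6.

(** [smooth_step] is the survival function of the sum of three independent uniform variables on
    [0, 1]; the bounds are checked on each cubic piece. *)
Lemma smooth_step_itv x : 0 <= smooth_step x <= 1.
Proof.
rewrite /smooth_step /pos_part.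
case: (lerP x 0) => x0; case: (lerP (x - 1) 0) => x1; case: (lerP (x - 2) 0) => x2;
  case: (lerP (x - 3) 0) => x3; try lra; rewrite ?expr0n/=.
- have H1 : x ^+ 3 <= 1 by rewrite exprn_ile1//; lra.
  have H2 : 0 <= x ^+ 3 by rewrite exprn_ge0//; lra.
  by apply/andP; split; lra.
- have [y0 y1] : 0 <= x - 1 /\ x - 1 <= 1 by split; lra.
  have -> : x = 1 + (x - 1) by ring.
  move: y0 y1; set y := x - 1 => y0 y1.
  have -> : 1 + y - 1 = y by ring.
  have H1 : 0 <= y * y * (1 - y) by rewrite !mulr_ge0//; lra.
  have H2 : 0 <= y * (1 - y) by rewrite !mulr_ge0//; lra.
  by rewrite !exprS expr0 !mulr1; apply/andP; split; nra.
- have H1 : 0 <= (3 - x) ^+ 3 by rewrite exprn_ge0//; lra.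
  have H2 : (3 - x) ^+ 3 <= 1 by rewrite exprn_ile1//; lra.
  rewrite (_ : 1 - _ = (3 - x) ^+ 3 / 6); last by field.
  by apply/andP; split; lra.
Qed.

Lemma smooth_step_le0 x : x <= 0 -> smooth_step x = 1.
Proof.
move=> x0; rewrite /smooth_step /pos_part !max_r; [|lra..].
by rewrite expr0n/=; ring.
Qed.

Lemma smooth_step_ge3 x : 3 <= x -> smooth_step x = 0.
Proof.
move=> x0; rewrite /smooth_step /pos_part !max_l; [|lra..].
by field.
Qed.

(** The remainders of the four cubes have total weight [(1 + 3 + 3 + 1) / 6 = 4 / 3], and half the
    second derivative is piecewise linear with values between -1/2 and 1/2; 2 and 1 are convenient
    upper bounds. *)
Lemma taylor3_smooth_step : taylor3 2 1 smooth_step.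
Proof.
exists (fun x => - (pos_part x ^+ 2 - 3 * pos_part (x - 1) ^+ 2
   + 3 * pos_part (x - 2) ^+ 2 - pos_part (x - 3) ^+ 2) / 2).
exists (fun x => - (pos_part x - 3 * pos_part (x - 1)
   + 3 * pos_part (x - 2) - pos_part (x - 3)) / 2).
split=> [x|x h].
  rewrite /pos_part ler_norml.
  by case: (lerP x 0) => x0; case: (lerP (x - 1) 0) => x1;
    case: (lerP (x - 2) 0) => x2; case: (lerP (x - 3) 0) => x3;
    apply/andP; split; lra.
have H0 := pos_part_cube_taylor x h.
have H1 := pos_part_cube_taylor (x - 1) h.
have H2 := pos_part_cube_taylor (x - 2) h.
have H3 := pos_part_cube_taylor (x - 3) h.
have h0 : 0 <= `|h| ^+ 3 by rewrite exprn_ge0.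
rewrite !(addrAC x _ h) in H1 H2 H3; rewrite /smooth_step.
by move: H0 H1 H2 H3; rewrite !ler_norml; lra.
Qed.

Definition scaled_step t h x := smooth_step ((x - t) / h).

Lemma taylor3_scaled_step t h : 0 < h ->
  taylor3 (2 / h ^+ 3) (1 / h ^+ 2) (scaled_step t h).
Proof.
move=> h0; have [a [b [bB fT]]] := taylor3_smooth_step.
exists (fun x => a ((x - t) / h) / h), (fun x => b ((x - t) / h) / h ^+ 2).
split=> [x|x k].
  have i0 : 0 <= (h ^+ 2)^-1 by rewrite invr_ge0 exprn_ge0// ltW.
  by rewrite normrM (ger0_norm i0) ler_wpM2r.
have h_ge0 : 0 <= h^-1 by rewrite invr_ge0 ltW.
have := fT ((x - t) / h) (k / h).
rewrite -mulrDl (addrAC x (- t)) normrM (ger0_norm h_ge0) -/(scaled_step t h x).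
rewrite -[f in `|f - _|]/(scaled_step t h (x + k)).
congr (`| _ - (_ + _ + _)| <= _); field; lra.
Qed.

Lemma scaled_step_itv t h x : 0 <= scaled_step t h x <= 1.
Proof. exact: smooth_step_itv. Qed.

Lemma scaled_step_ge t h x : 0 < h -> (x <= t)%R%:R <= scaled_step t h x.
Proof.
move=> h0; have /andP[f0 _] := scaled_step_itv t h x.
case: (lerP x t) => [xt|//]; rewrite /scaled_step smooth_step_le0//.
by rewrite pmulr_lle0 ?invr_gt0// subr_le0.
Qed.

(** The indicator can be strict because the step already vanishes at [t + 3 * h]; this later bounds
    probabilities of strict inequalities from below, atoms included. *)
Lemma scaled_step_le t h x : 0 < h -> scaled_step t h x <= (x < t + 3 * h)%R%:R.
Proof.
move=> h0; have /andP[_ f1] := scaled_step_itv t h x.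
case: (ltrP x (t + 3 * h)) => [//|xt]; rewrite /scaled_step smooth_step_ge3//.
by rewrite ler_pdivlMr//; lra.
Qed.

End taylor_class.

(** * Sums of random signs *)

Section central_binomial.

Lemma bin_le_half n j : ('C(n, j) <= 'C(n, n./2))%N.
Proof.
have up i k : (i + k <= n./2)%N -> ('C(n, i) <= 'C(n, i + k))%N.
  elim: k => [|k IHk] ik; first by rewrite addn0.
  apply: leq_trans (IHk _) _; first by rewrite (leq_trans _ ik)// leq_add2l.
  rewrite addnS -(@leq_pmul2l (i + k).+1)// mul_bin_left leq_mul2r.
  apply/orP; right; have := odd_double_half n; lia.
case: (leqP j n./2) => jn; first by rewrite -(subnKC jn) up// subnKC.
case: (leqP j n) => jn'; last by rewrite bin_small.
rewrite -bin_sub//; have h : (n - j <= n./2)%N by have := odd_double_half n; lia.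
by rewrite -(subnKC h) up// subnKC.
Qed.

(** Passing from [m] to [m + 1] multiplies the coefficient by [2 * (2m + 1) / (m + 1)], so the step
    amounts to [(2m + 1) * (2m + 3) <= 4 * (m + 1) ^ 2]. With [2m] in place of the factor [2m + 1]
    the induction would not close. *)
Lemma central_bin_bound m : ((m.*2.+1) * 'C(m.*2, m) ^ 2 <= 16 ^ m)%N.
Proof.
elim: m => [//|m IHm].
have e : (m.+1 * 'C(m.+1.*2, m.+1) = m.*2.+1.*2 * 'C(m.*2, m))%N.
  have h1 := mul_bin_diag m.*2.+1 m.
  have h2 : (m.+1 * 'C(m.*2.+1, m) = m.*2.+1 * 'C(m.*2, m))%N.
    have := mul_bin_down m.*2.+1 m; rewrite /= => ->.
    by rewrite -addnn subSn ?leq_addr// addnK.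
  by rewrite doubleS binS mulnDr -h1 h2 addnn doubleMl.
rewrite -(@leq_pmul2l (m.+1 ^ 2)) ?expn_gt0//.
have -> : (m.+1 ^ 2 * (m.+1.*2.+1 * 'C(m.+1.*2, m.+1) ^ 2) =
  m.+1.*2.+1 * (m.+1 * 'C(m.+1.*2, m.+1)) ^ 2)%N by rewrite expnMn; ring.
rewrite e.
have -> : (m.+1.*2.+1 * (m.*2.+1.*2 * 'C(m.*2, m)) ^ 2 =
  (4 * m.+1.*2.+1 * m.*2.+1) * (m.*2.+1 * 'C(m.*2, m) ^ 2))%N.
  by rewrite -!muln2 !expnMn; ring.
apply: leq_trans (leq_mul (leqnn _) IHm) _.
rewrite (expnS 16) mulnA leq_mul2r; apply/orP; right; nia.
Qed.

(** An integer form of the bound [1 / sqrt n] on the atoms of the sum of signs. Odd rows reduce to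
    the even row that follows, whose central coefficient is twice theirs. *)
Lemma bin_sqr_bound n j : (n * 'C(n, j) ^ 2 <= 4 ^ n)%N.
Proof.
apply: leq_trans (_ : n * 'C(n, n./2) ^ 2 <= _)%N.
  by rewrite leq_mul// leq_exp2r// bin_le_half.
have := odd_double_half n; case: (odd n) => /=; move: n./2 => m <-.
  rewrite add1n; have := central_bin_bound m.+1.
  have e : 'C(m.+1.*2, m.+1) = 'C(m.*2.+1, m).*2.
    rewrite doubleS binS -[RHS]addnn; congr (_ + _)%N.
    have h : (m <= m.*2.+1)%N by rewrite -addnn leqW// leq_addr.
    by rewrite -(bin_sub h) -addnn subSn ?leq_addr// addnK.
  have -> : (4 ^ m.*2.+1 = 4 * 16 ^ m)%N by rewrite expnS -mul2n expnM.
  rewrite e -(muln2 'C(_, _)) (expnMn _ 2) (expnS 16); nia.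
rewrite add0n -mul2n expnM mul2n; apply: leq_trans (central_bin_bound m).
by rewrite leq_mul2r leqnSn orbT.
Qed.

End central_binomial.

Section rademacher.
Variable R : realType.
Implicit Types (s t h x c : R) (g : R -> R) (n : nat).

Lemma iter_sign_meanE n s g x : iter n (sign_mean s) g x =
  \sum_(j < n.+1) 'C(n, j)%:R / 2 ^+ n * g (x + (2 * j%:R - n%:R) * s).
Proof.
elim: n x => [|n IHn] x.
  by rewrite big_ord_recl big_ord0 /= expr0 ?bin0 subr0 mulr0 mul0r !addr0 divr1 mul1r.
rewrite iterS {1}/sign_mean !IHn.
rewrite [RHS]big_ord_recl/= ?bin0.
under [X in _ = _ + X]eq_bigr => j _.
  rewrite /bump/= add1n binS natrD mulrDl mulrDl.
  over.
rewrite big_split/= addrA.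
have -> : 1 / 2 ^+ n.+1 * g (x + (2 * 0 - n.+1%:R) * s) +
   \sum_(i < n.+1) 'C(n, i.+1)%:R / 2 ^+ n.+1 * g (x + (2 * i.+1%:R - n.+1%:R) * s)
  = \sum_(i < n.+1) 'C(n, i)%:R / 2 ^+ n.+1 * g (x + (2 * i%:R - n.+1%:R) * s).
  transitivity (\sum_(i < n.+2) 'C(n, i)%:R / 2 ^+ n.+1 * g (x + (2 * i%:R - n.+1%:R) * s)).
    by rewrite [RHS]big_ord_recl/= ?bin0.
  by rewrite big_ord_recr/= bin_small// !mul0r addr0.
rewrite [LHS]mulrDl [LHS]addrC; congr (_ + _); rewrite mulr_suml; apply: eq_bigr => j _.
  have -> : x - s + (2 * j%:R - n%:R) * s = x + (2 * j%:R - n.+1%:R) * s.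
    by rewrite -(natr1 n); ring.
  by rewrite exprS invfM; ring.
have -> : x + s + (2 * j%:R - n%:R) * s = x + (2 * j.+1%:R - n.+1%:R) * s.
  by rewrite -(natr1 n) -(natr1 j); ring.
by rewrite exprS invfM; ring.
Qed.

Lemma sum_itv_indic (a b : R) (m : nat) : a <= b ->
  \sum_(j < m) ((a < j%:R <= b)%R%:R : R) <= b - a + 1.
Proof.
(* The induction on [m] needs a bound that remembers the range: the indices counted stop at [b] or
   at [m - 1], whichever is smaller. *)
move=> ab; suff : \sum_(j < m) ((a < j%:R <= b)%R%:R : R) <=
    Num.max 0 (Num.min (b + 1) m%:R - a).
  move/le_trans; apply; rewrite ge_max; apply/andP; split; first lra.
  by rewrite lerBlDr ge_min; apply/orP; left; lra.
elim: m => [|m IHm]; first by rewrite big_ord0 le_max lexx.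
rewrite big_ord_recr/= -natr1; move: IHm.
rewrite /Num.max /Num.min.
case: (ltrP a m%:R) => am; case: (lerP m%:R b) => mb /=; rewrite ?addr0;
  case: (ltrP (b + 1) m%:R) => b1; case: (ltrP (b + 1) (m%:R + 1)) => b2;
  case: ltP => c1; case: ltP => c2; lra.
Qed.

Lemma bin_le_inv_sqrt n j : (0 < n)%N ->
  'C(n, j)%:R / 2 ^+ n <= (Num.sqrt n%:R)^-1 :> R.
Proof.
move=> n0; have s0 : 0 < Num.sqrt n%:R :> R by rewrite sqrtr_gt0 ltr0n.
rewrite ler_pdivrMr ?exprn_gt0// mulrC ler_pdivlMr//.
rewrite -(@ler_sqr _ _ (2 ^+ n)) ?nnegrE ?exprn_ge0 ?mulr_ge0 ?sqrtr_ge0//.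
rewrite exprMn sqr_sqrtr// -!natrX -natrM ler_nat mulnC -expnM (mulnC n 2) expnM.
exact: bin_sqr_bound.
Qed.

(** The walk lives on a lattice of spacing [2 * s] with atoms of mass at most [s = 1 / sqrt n]. An
    interval of length [b - a] holds at most [(b - a) / (2 * s) + 1] of its points, hence has mass
    at most [(b - a) / 2 + s]. *)
Lemma iter_sign_mean_itv_le n (a b : R) x : (0 < n)%N -> a <= b ->
  iter n (sign_mean (Num.sqrt n%:R)^-1) (fun y => (a < y <= b)%R%:R) x <=
  b - a + (Num.sqrt n%:R)^-1.
Proof.
move=> n0 ab; set s := (Num.sqrt n%:R)^-1; have s0 : 0 < s by rewrite invr_gt0 sqrtr_gt0 ltr0n.
rewrite iter_sign_meanE.
apply: (@le_trans _ _ (\sum_(j < n.+1) s *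
    (((a - x) / s + n%:R) / 2 < j%:R <= ((b - x) / s + n%:R) / 2)%R%:R)).
  apply: ler_sum => j _; apply: ler_pM; rewrite ?divr_ge0 ?exprn_ge0//.
    exact: bin_le_inv_sqrt.
  rewrite ltr_pdivrMr// ler_pdivlMr// -ltrBrDr -lerBlDr ltr_pdivrMr// ler_pdivlMr//.
  by rewrite ltrBlDl lerBrDl (mulrC _ 2).
rewrite -mulr_sumr; have h : ((a - x) / s + n%:R) / 2 <= ((b - x) / s + n%:R) / 2.
  by rewrite ler_wpM2r ?invr_ge0// lerD2r ler_wpM2r ?lerD2r// invr_ge0 (ltW s0).
apply: le_trans (ler_wpM2l (ltW s0) (sum_itv_indic n.+1 h)) _.
have -> : s * (((b - x) / s + n%:R) / 2 - ((a - x) / s + n%:R) / 2 + 1) =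
  (b - a) / 2 + s by field; rewrite gt_eqF.
lra.
Qed.

Lemma iter_sign_mean_le n s g1 g2 x : (forall y, g1 y <= g2 y) ->
  iter n (sign_mean s) g1 x <= iter n (sign_mean s) g2 x.
Proof.
move=> g12; elim: n x => [|n IHn] x //=.
by rewrite ler_pM2r// lerD.
Qed.

Lemma iter_sign_meanD n s g1 g2 x :
  iter n (sign_mean s) (fun y => g1 y + g2 y) x =
  iter n (sign_mean s) g1 x + iter n (sign_mean s) g2 x.
Proof.
elim: n x => [|n IHn] x //=; rewrite {1}/sign_mean !IHn /sign_mean; lra.
Qed.

Lemma iter_sign_meanN n s g x :
  iter n (sign_mean s) (fun y => g (- y)) x = iter n (sign_mean s) g (- x).
Proof.
elim: n x => [|n IHn] x //=; rewrite {1}/sign_mean !IHn /sign_mean.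
by rewrite addrC opprB opprD (addrC s).
Qed.

Lemma iter_sign_mean_local n s g x c :
  (forall y, `|y - x| <= n%:R * `|s| -> g y = c) ->
  iter n (sign_mean s) g x = c.
Proof.
elim: n x => [|n IHn] x gc /=; first by apply: gc; rewrite subrr normr0 mul0r.
rewrite /sign_mean !IHn; first by field.
- move=> y yx; apply: gc.
  rewrite (_ : y - x = (y - (x - s)) - s); last by ring.
  rewrite (le_trans (ler_normB _ _))// -natr1 mulrDl mul1r lerD2r//.
- move=> y yx; apply: gc.
  rewrite (_ : y - x = (y - (x + s)) + s); last by ring.
  by rewrite (le_trans (ler_normD _ _))// -natr1 mulrDl mul1r lerD2r.
Qed.

Lemma iter_sign_mean_cst n s c x : iter n (sign_mean s) (fun=> c) x = c.
Proof. by apply: iter_sign_mean_local. Qed.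

End rademacher.

(** * Distribution function of the normalized sum of signs *)

Section sign_cdf.
Variable R : realType.
Implicit Types (t h x c u : R) (g : R -> R) (n : nat).

Definition sign_cdf n t : R :=
  iter n (sign_mean (Num.sqrt n%:R)^-1) (fun x => (x <= t)%R%:R) 0.

Lemma sign_cdf_homo n : {homo sign_cdf n : t h / t <= h}.
Proof.
move=> t h th; apply: iter_sign_mean_le => y.
by rewrite ler_nat; case: (lerP y t) => // yt; rewrite (le_trans yt th).
Qed.

Lemma sign_cdfD_le n t h : (0 < n)%N -> 0 <= h ->
  sign_cdf n (t + h) <= sign_cdf n t + (h + (Num.sqrt n%:R)^-1).
Proof.
move=> n0 h0.
have th : t <= t + h by lra.
have := iter_sign_mean_itv_le 0 n0 th.
rewrite /= (_ : t + h - t = h); last ring.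
move=> H; apply: le_trans (lerD (lexx _) H).
rewrite /sign_cdf -iter_sign_meanD; apply: iter_sign_mean_le => y.
rewrite -natrD ler_nat; case: (lerP y (t + h)) => //= yt.
by case: (lerP y t).
Qed.

Lemma sign_cdfN_ge n c : 1 - sign_cdf n c <= sign_cdf n (- c).
Proof.
rewrite lerBlDr /sign_cdf.
rewrite -[in X in _ <= _ + X](oppr0 R) -iter_sign_meanN -iter_sign_meanD.
rewrite -[X in X <= _](iter_sign_mean_cst n (Num.sqrt n%:R)^-1 1 (0 : R)).
apply: iter_sign_mean_le => y; rewrite -natrD (ler_nat _ 1).
by case: (lerP y (- c)) => // yc; rewrite lerNl ltW.
Qed.

(** Exact symmetry fails only by the atom at [c]; stepping back to [c - h] avoids it, and the
    increment bound recovers [sign_cdf n c]. *)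
Lemma sign_cdfN_le n c h : (0 < n)%N -> 0 < h ->
  sign_cdf n (- c) <= 1 - sign_cdf n c + (h + (Num.sqrt n%:R)^-1).
Proof.
move=> n0 h0; suff H : sign_cdf n (- c) + sign_cdf n (c - h) <= 1.
  have := sign_cdfD_le (c - h) n0 (ltW h0).
  rewrite (_ : c - h + h = c); [lra|ring].
rewrite /sign_cdf.
rewrite -[in X in _ + X](oppr0 R) -iter_sign_meanN -iter_sign_meanD.
rewrite -[X in _ <= X](iter_sign_mean_cst n (Num.sqrt n%:R)^-1 1 (0 : R)).
apply: iter_sign_mean_le => y; rewrite -natrD (ler_nat _ _ 1).
by case: (lerP y (- c)) => yc; case: (lerP (- y) (c - h)) => yh//; lra.
Qed.

(** Only an approximate inverse exists, since a step function may jump over [u]. A point [x] is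
    chosen within [h] of the supremum of the set where the function is below [u]: [x + h] lies
    beyond that supremum, and the increment bound from [x] limits the overshoot. *)
Lemma sign_cdf_quantile n h u : (0 < n)%N -> 0 < h -> 0 < u < 1 ->
  exists c, u <= sign_cdf n c <= u + (h + (Num.sqrt n%:R)^-1).
Proof.
move=> n0 h0 /andP[u0 u1]; set s := (Num.sqrt n%:R)^-1.
have s0 : 0 < s by rewrite invr_gt0 sqrtr_gt0 ltr0n.
pose A := [set x | sign_cdf n x < u].
have A_lo : A (- (n%:R * s) - 1).
  rewrite /A/= /sign_cdf -/s (@iter_sign_mean_local _ _ _ _ _ 0)// => y.
  rewrite subr0 (ger0_norm (ltW s0)) ler_norml => /andP[yn _].
  by case: lerP => //; lra.
have A_ub : ubound A (n%:R * s).
  move=> x Ax; rewrite leNgt; apply/negP => xn.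
  suff e : sign_cdf n x = 1 by move: Ax; rewrite /A/= e; lra.
  rewrite /sign_cdf -/s (@iter_sign_mean_local _ _ _ _ _ 1)// => y.
  rewrite subr0 (ger0_norm (ltW s0)) ler_norml => /andP[_ yn].
  by case: lerP => //; lra.
have hsA : has_sup A by split; [exists (- (n%:R * s) - 1)|exists (n%:R * s)].
have [x Ax xh] := sup_adherent h0 hsA.
exists (x + h); apply/andP; split.
  rewrite leNgt; apply/negP => Axh.
  have := ub_le_sup hsA.2 Axh; lra.
by have := sign_cdfD_le x n0 (ltW h0); move: Ax; rewrite /A/= -/s; lra.
Qed.

End sign_cdf.

(** * Sums of draws with replacement *)

Section empirical_mean.
Variables (R : realType) (N : nat).
Hypothesis N0 : (0 < N)%N.
Implicit Types (u v : 'I_N -> R) (c : R).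

Lemma emp_meanD u v :
  emp_mean (fun j => u j + v j) = emp_mean u + emp_mean v.
Proof. by rewrite /emp_mean big_split mulrDr. Qed.

Lemma emp_meanZ c u : emp_mean (fun j => c * u j) = c * emp_mean u.
Proof. by rewrite /emp_mean -mulr_sumr mulrCA. Qed.

Lemma emp_mean_cst c : emp_mean (fun _ : 'I_N => c) = c.
Proof.
rewrite /emp_mean sumr_const card_ord -[c *+ N]mulr_natl mulKf//.
by rewrite pnatr_eq0 -lt0n.
Qed.

Lemma ler_emp_mean u v : (forall j, u j <= v j) -> emp_mean u <= emp_mean v.
Proof. by move=> uv; rewrite ler_wpM2l ?invr_ge0 ?ler0n// ler_sum. Qed.

Lemma emp_mean_sqr_le u : emp_mean u ^+ 2 <= emp_mean (fun j => u j ^+ 2).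
Proof.
have : 0 <= emp_mean (fun j => u j ^+ 2 + (-2 * emp_mean u) * u j + emp_mean u ^+ 2).
  rewrite -[X in X <= _](emp_mean_cst 0); apply: ler_emp_mean => j.
  rewrite (_ : _ + _ = (u j - emp_mean u) ^+ 2) ?sqr_ge0//; ring.
rewrite !emp_meanD emp_meanZ emp_mean_cst; lra.
Qed.

Lemma emp_mean_centered u : emp_mean (fun j => u j - emp_mean u) = 0.
Proof. by rewrite emp_meanD emp_mean_cst subrr. Qed.

Lemma emp_mean_centered_sqr u : emp_mean (fun j => (u j - emp_mean u) ^+ 2) =
  emp_mean (fun j => u j ^+ 2) - emp_mean u ^+ 2.
Proof.
transitivity (emp_mean
    (fun j => u j ^+ 2 + (-2 * emp_mean u) * u j + emp_mean u ^+ 2)).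
  by rewrite /emp_mean; congr (_ * _); apply: eq_bigr => j _; ring.
by rewrite !emp_meanD emp_meanZ emp_mean_cst; ring.
Qed.

(** Since [|x| ^ 3 <= x ^ 2 + x ^ 4], the variance contributes at most 1 plus the mean of [u ^ 4].
    The centered fourth power contributes 16 times that mean, through
    [(u - m) ^ 4 <= 8 * u ^ 4 + 8 * m ^ 4] and Jensen's inequality for [m ^ 4]. *)
Lemma emp_mean_centered_cube_le u :
  emp_mean (fun j => `|u j - emp_mean u| ^+ 3) <=
  1 + 17 * emp_mean (fun j => u j ^+ 4).
Proof.
have h1 := emp_mean_sqr_le u.
have h2 := emp_mean_sqr_le (fun j => u j ^+ 2).
set m := emp_mean u in h1 *.
have m4 : m ^+ 4 <= emp_mean (fun j => u j ^+ 4).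
  rewrite (exprM m 2 2); under [X in _ <= emp_mean X]eq_fun do rewrite (exprM _ 2 2).
  by apply: le_trans h2; rewrite ler_sqr ?nnegrE ?sqr_ge0 ?(le_trans _ h1) ?sqr_ge0.
have cub (x : R) : `|x| ^+ 3 <= x ^+ 2 + x ^+ 4.
  rewrite -(ger0_norm (exprn_even_ge0 x (erefl : ~~ odd 2))).
  rewrite -(ger0_norm (exprn_even_ge0 x (erefl : ~~ odd 4))) !normrX.
  have := normr_ge0 x; set y := `|x| => y0.
  have : 0 <= y * y * (1 - y + y ^+ 2).
    by rewrite !mulr_ge0//; nra.
  by rewrite !exprS expr0; nra.
apply: (@le_trans _ _ (emp_mean (fun j => (u j - m) ^+ 2 + (8 * u j ^+ 4 + 8 * m ^+ 4)))).
  apply: ler_emp_mean => j; apply: (le_trans (cub _)); rewrite lerD2l.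
  (* This product is a factorization of [8 * u ^ 4 + 8 * m ^ 4 - (u - m) ^ 4]. *)
  have : 0 <= (u j + m) ^+ 2 * (7 * u j ^+ 2 - 10 * u j * m + 7 * m ^+ 2).
    rewrite mulr_ge0 ?sqr_ge0//.
    have -> : 7 * u j ^+ 2 - 10 * u j * m + 7 * m ^+ 2 =
      5 * (u j - m) ^+ 2 + 2 * u j ^+ 2 + 2 * m ^+ 2 by ring.
    have := sqr_ge0 (u j - m); have := sqr_ge0 (u j); have := sqr_ge0 m; lra.
  rewrite -subr_ge0 => H; rewrite -subr_ge0; apply: le_trans H _.
  by rewrite le_eqVlt; apply/orP; left; apply/eqP; ring.
rewrite !emp_meanD emp_meanZ emp_mean_cst emp_mean_centered_sqr -/m.
have : emp_mean (fun j => u j ^+ 2) <= emp_mean (fun j => 1 + u j ^+ 4).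
  apply: ler_emp_mean => j /=; have := sqr_ge0 (u j); set y := u j ^+ 2 => y0.
  by rewrite (exprM _ 2 2) -/y; nra.
rewrite emp_meanD emp_mean_cst; have := sqr_ge0 m; lra.
Qed.

End empirical_mean.

Section empirical_operator.
Variables (R : realType) (N : nat).
Hypothesis N0 : (0 < N)%N.
Implicit Types (v : 'I_N -> R) (g : R -> R) (x s M B : R).

(** Adds one draw from the values [v j], as [sign_mean] adds one sign. Expectations over the draws
    given the sample become iterates of this operator. *)
Definition emp_step v g x := emp_mean (fun j => g (x + v j)).

Lemma iter_emp_stepE v g k x : iter k (emp_step v) g x =
  (N%:R ^+ k)^-1 * \sum_(f : {ffun 'I_k -> 'I_N}) g (x + \sum_i v (f i)).
Proof.
elim: k x => [|k IHk] x /=.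
  rewrite expr0 invr1 mul1r (big_pred1 [ffun i : 'I_0 => ltac:(by case: i)]).
    by rewrite big_ord0 addr0.
  by move=> f; apply/esym/eqP/ffunP => -[].
rewrite -[LHS]/(emp_mean (fun j => iter k (emp_step v) g (x + v j))) /emp_mean.
under [X in _ * X = _]eq_bigr => j _ do rewrite IHk.
rewrite -mulr_sumr mulrA -invfM -exprS pair_big/=.
congr (_ * _).
pose F (p : 'I_N * {ffun 'I_k -> 'I_N}) : {ffun 'I_k.+1 -> 'I_N} :=
  [ffun i => oapp p.2 p.1 (unlift ord0 i)].
rewrite [RHS](reindex F)/=; last first.
  exists (fun f => (f ord0, [ffun i => f (lift ord0 i)])) => [[a f] _|f _]/=.
    rewrite /F ffunE unlift_none/=; congr pair.
    by apply/ffunP => i; rewrite !ffunE liftK.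
  apply/ffunP => i; rewrite /F ffunE/=.
  by case: unliftP => [j ->|->] //=; rewrite ffunE.
apply: eq_bigr => -[a f] _ /=; rewrite big_ord_recl addrA /F ffunE unlift_none/=.
by congr (g (_ + _)); apply: eq_bigr => i _; rewrite ffunE liftK.
Qed.

(** Both averages expand [g] around the same [x]: the first-order terms vanish since [v] is centered
    and the signs are symmetric, and the second-order terms share the coefficient [b x], leaving the
    gap between the variances and the cubic remainders. *)
Lemma emp_step_sign_mean v s M B g x : taylor3 M B g -> 0 <= s ->
  emp_mean v = 0 ->
  `|emp_step v g x - sign_mean s g x| <=
  B * `|emp_mean (fun j => v j ^+ 2) - s ^+ 2| +
  M * (emp_mean (fun j => `|v j| ^+ 3) + s ^+ 3).
Proof.
move=> [a [b [bB gT]]] s0 v0; rewrite /sign_mean.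
have h1 := gT x s; have h2 := gT x (- s).
rewrite normrN (ger0_norm s0) in h1 h2.
set m2 := emp_mean _; set m3 := emp_mean _.
have h3 : emp_step v g x <= g x + b x * m2 + M * m3.
  apply: (@le_trans _ _ (emp_mean
      (fun j => g x + (a x * v j + (b x * v j ^+ 2 + M * `|v j| ^+ 3))))).
    by apply: ler_emp_mean => j /=; have := gT x (v j); rewrite ler_norml; lra.
  by rewrite !emp_meanD !emp_meanZ emp_mean_cst// v0 -/m2 -/m3; lra.
have h4 : g x + b x * m2 - M * m3 <= emp_step v g x.
  apply: (@le_trans _ _ (emp_mean
      (fun j => g x + (a x * v j + (b x * v j ^+ 2 + - M * `|v j| ^+ 3))))).
    by rewrite !emp_meanD !emp_meanZ emp_mean_cst// v0 -/m2 -/m3; lra.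
  by apply: ler_emp_mean => j /=; have := gT x (v j); rewrite ler_norml; lra.
have h5 : `|b x * (m2 - s ^+ 2)| <= B * `|m2 - s ^+ 2|.
  by rewrite normrM ler_wpM2r.
rewrite sqrrN in h2; move: h1 h2 h5; rewrite !ler_norml => h1 h2 h5.
apply/andP; split; lra.
Qed.

(** Telescoping works because the steps already replaced form an iterate of [sign_mean], which stays
    in the class with the same constants, while [emp_step], being an average, does not enlarge a
    uniform error. *)
Lemma iter_emp_step_sign_mean v s M B g k x : taylor3 M B g -> 0 <= s ->
  emp_mean v = 0 ->
  `|iter k (emp_step v) g x - iter k (sign_mean s) g x| <=
  k%:R * (B * `|emp_mean (fun j => v j ^+ 2) - s ^+ 2| +
          M * (emp_mean (fun j => `|v j| ^+ 3) + s ^+ 3)).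
Proof.
move=> gT s0 v0; elim: k x => [|k IHk] x; first by rewrite subrr normr0 mul0r.
have := emp_step_sign_mean x (taylor3_iter_sign_mean s k gT) s0 v0.
move: IHk; set d := (X in k%:R * X) => IHk.
set G := iter k (sign_mean s) g in IHk *; rewrite !iterS => h1.
have h2 : `|emp_step v (iter k (emp_step v) g) x - emp_step v G x| <= k%:R * d.
  rewrite ler_norml; apply/andP; split.
    rewrite lerBrDr -[X in X + _](emp_mean_cst N0) -emp_meanD.
    by apply: ler_emp_mean => j /=; have := IHk (x + v j); rewrite ler_norml; lra.
  rewrite lerBlDr -[X in X + _](emp_mean_cst N0) -emp_meanD.
  by apply: ler_emp_mean => j /=; have := IHk (x + v j); rewrite ler_norml; lra.
by rewrite -natr1; move: h1 h2; rewrite -?/d -?/G !ler_norml; lra.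
Qed.

Lemma iter_emp_step_sqr v k x : iter k (emp_step v) (fun y => y ^+ 2) x =
  (x + k%:R * emp_mean v) ^+ 2 +
  k%:R * (emp_mean (fun j => v j ^+ 2) - emp_mean v ^+ 2).
Proof.
elim: k x => [|k IHk] x; first by rewrite /= !mul0r !addr0.
rewrite -[LHS]/(emp_mean (fun j => iter k (emp_step v) (fun y => y ^+ 2) (x + v j))).
set m := emp_mean v; set w := emp_mean (fun j => v j ^+ 2).
transitivity (emp_mean (fun j => (x + k%:R * m) ^+ 2 + k%:R * (w - m ^+ 2) +
    (2 * (x + k%:R * m) * v j + v j ^+ 2))).
  by rewrite /emp_mean; congr (_ * _); apply: eq_bigr => j _;
    rewrite IHk -/m -/w; ring.
by rewrite !emp_meanD !emp_meanZ !emp_mean_cst// -/m -/w -natr1; ring.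
Qed.

End empirical_operator.

(** * Resampled sums against random signs *)

Section bootstrap_clt.
Variables (R : realType) (N : nat).
Hypothesis N0 : (0 < N)%N.
Implicit Types (D : 'I_N -> R) (h : R).

Let s : R := (Num.sqrt N%:R)^-1.

Let s_gt0 : 0 < s. Proof. by rewrite invr_gt0 sqrtr_gt0 ltr0n. Qed.

Lemma inv_sqrt_sqr : (Num.sqrt N%:R)^-1 ^+ 2 = N%:R^-1 :> R.
Proof. by rewrite exprVn sqr_sqrtr. Qed.

(** [3 * h + s] is the price of smoothing an indicator over a width [3 * h]. Next come the gap
    between the empirical variance and 1, and the cubic remainder, where one unit of the 2 accounts
    for the signs. *)
Definition boot_clt_err h D : R :=
  3 * h + s +
  (`|emp_mean (fun j => D j ^+ 2) - 1| + emp_mean D ^+ 2) / h ^+ 2 +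
  2 * s * (2 + 17 * emp_mean (fun j => D j ^+ 4)) / h ^+ 3.

Let v D j : R := s * (D j - emp_mean D).

(** Centering at the empirical mean moves the threshold 0 for the drawn contrasts to
    [- (s * \sum_j D j)], the point where [sign_cdf] is evaluated. *)
Let sum_v D (f : {ffun 'I_N -> 'I_N}) :
  \sum_i v D (f i) = s * (\sum_i D (f i)) - s * (\sum_j D j).
Proof.
rewrite /v -mulr_sumr sumrB sumr_const card_ord -mulrBr /emp_mean.
by rewrite -[X in _ - X]mulr_natl mulVKf// pnatr_eq0 -lt0n.
Qed.

Let lindeberg h t D : 0 < h ->
  `|iter N (emp_step (v D)) (scaled_step t h) 0 -
    iter N (sign_mean s) (scaled_step t h) 0| <=
  (`|emp_mean (fun j => D j ^+ 2) - 1| + emp_mean D ^+ 2) / h ^+ 2 +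
  2 * s * (2 + 17 * emp_mean (fun j => D j ^+ 4)) / h ^+ 3.
Proof.
move=> h0.
have v0 : emp_mean (v D) = 0.
  by rewrite emp_meanZ emp_mean_centered// mulr0.
apply: (le_trans (iter_emp_step_sign_mean N0 N 0 (taylor3_scaled_step t h0)
  (ltW s_gt0) v0)).
have -> : emp_mean (fun j => v D j ^+ 2) =
    s ^+ 2 * emp_mean (fun j => (D j - emp_mean D) ^+ 2).
  by rewrite -emp_meanZ; congr emp_mean; apply/funext => j; rewrite exprMn.
have -> : emp_mean (fun j => `|v D j| ^+ 3) =
    s ^+ 3 * emp_mean (fun j => `|D j - emp_mean D| ^+ 3).
  rewrite -emp_meanZ; congr emp_mean; apply/funext => j.
  by rewrite normrM (ger0_norm (ltW s_gt0)) exprMn.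
rewrite emp_mean_centered_sqr//.
have := emp_mean_centered_cube_le N0 D.
set m := emp_mean D; set m2 := emp_mean (fun j => D j ^+ 2).
set m3 := emp_mean (fun j => `|_| ^+ 3); set m4 := emp_mean (fun j => D j ^+ 4).
move=> m3_le; have Ns : N%:R * s ^+ 2 = 1.
  by rewrite /s inv_sqrt_sqr mulfV// pnatr_eq0 -lt0n.
have hi0 : 0 < h^-1 by rewrite invr_gt0.
rewrite mulrDr lerD//.
  have -> : s ^+ 2 * (m2 - m ^+ 2) - s ^+ 2 = s ^+ 2 * (m2 - 1 - m ^+ 2) by ring.
  rewrite normrM (ger0_norm (sqr_ge0 s)).
  have -> : N%:R * (1 / h ^+ 2 * (s ^+ 2 * `|m2 - 1 - m ^+ 2|)) =
    (N%:R * s ^+ 2) * `|m2 - 1 - m ^+ 2| / h ^+ 2 by ring.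
  rewrite Ns mul1r ler_wpM2r ?invr_ge0 ?exprn_ge0 ?(ltW h0)//.
  by rewrite (le_trans (ler_normB _ _))// (ger0_norm (sqr_ge0 m)).
have -> : N%:R * (2 / h ^+ 3 * (s ^+ 3 * m3 + s ^+ 3)) =
  (N%:R * s ^+ 2) * (2 * s * (1 + m3)) / h ^+ 3 by ring.
rewrite Ns mul1r ler_wpM2r ?invr_ge0 ?exprn_ge0 ?(ltW h0)//.
rewrite ler_wpM2l ?mulr_ge0 ?(ltW s_gt0)//; lra.
Qed.

Lemma boot_clt_le h D : 0 < h ->
  (N%:R ^+ N)^-1 * \sum_(f : {ffun 'I_N -> 'I_N}) (\sum_i D (f i) <= 0)%R%:R <=
  sign_cdf N (- (s * \sum_j D j)) + boot_clt_err h D.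
Proof.
move=> h0; set t := - (s * _).
have h3 : 0 <= 3 * h by lra.
have := lindeberg t D h0; rewrite ler_norml => /andP[_].
have := sign_cdfD_le t N0 h3; rewrite -/s.
have : iter N (sign_mean s) (scaled_step t h) 0 <= sign_cdf N (t + 3 * h).
  apply: iter_sign_mean_le => y; apply: (le_trans (scaled_step_le t y h0)).
  by rewrite ler_nat; case: ltP => // /ltW ->.
have : (N%:R ^+ N)^-1 *
    \sum_(f : {ffun 'I_N -> 'I_N}) (\sum_i D (f i) <= 0)%R%:R <=
    iter N (emp_step (v D)) (scaled_step t h) 0.
  rewrite iter_emp_stepE ler_wpM2l ?invr_ge0 ?exprn_ge0//.
  apply: ler_sum => f _; rewrite add0r.
  apply: le_trans (scaled_step_ge _ _ h0); rewrite ler_nat sum_v.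
  by rewrite /t lerBlDr addNr pmulr_rle0.
rewrite /boot_clt_err; lra.
Qed.

(** The step is placed at [t - 3 * h] so that it vanishes from [t] on. The strict inequality on the
    draws is what the left limit of the bootstrap distribution function requires. *)
Lemma boot_clt_ge h D : 0 < h ->
  sign_cdf N (- (s * \sum_j D j)) - boot_clt_err h D <=
  (N%:R ^+ N)^-1 * \sum_(f : {ffun 'I_N -> 'I_N}) (\sum_i D (f i) < 0)%R%:R.
Proof.
move=> h0; set t := - (s * _); set t' := t - 3 * h.
have h3 : 0 <= 3 * h by lra.
have := lindeberg t' D h0; rewrite ler_norml => /andP[+ _].
have := sign_cdfD_le t' N0 h3; rewrite -/s subrK.
have : sign_cdf N t' <= iter N (sign_mean s) (scaled_step t' h) 0.
  by apply: iter_sign_mean_le => y; exact: scaled_step_ge.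
have : iter N (emp_step (v D)) (scaled_step t' h) 0 <= (N%:R ^+ N)^-1 *
    \sum_(f : {ffun 'I_N -> 'I_N}) (\sum_i D (f i) < 0)%R%:R.
  rewrite iter_emp_stepE ler_wpM2l ?invr_ge0 ?exprn_ge0//.
  apply: ler_sum => f _; rewrite add0r.
  apply: (le_trans (scaled_step_le _ _ h0)); rewrite ler_nat sum_v subrK.
  by rewrite /t ltrBlDr addNr pmulr_rlt0.
rewrite /boot_clt_err; lra.
Qed.

End bootstrap_clt.

(** * Independent sums *)

Section independence.
Context d (W : measurableType d) (R : realType) (P : probability W R).
Local Open Scope ereal_scope.

(** Both sides are finite measures in [E] that agree on rectangles, a system stable under
    intersection which generates the product sigma-algebra. *)
Lemma prod_preimage_indep d1 d2 (T1 : measurableType d1) (T2 : measurableType d2)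
    (U : W -> T1) (V : W -> T2) (C : set W) :
  measurable_fun setT U -> measurable_fun setT V -> measurable C ->
  (forall A B, measurable A -> measurable B ->
    P (U @^-1` A `&` V @^-1` B `&` C) = P (U @^-1` A `&` V @^-1` B) * P C) ->
  forall E, measurable E ->
    P ((fun w => (U w, V w)) @^-1` E `&` C) = P ((fun w => (U w, V w)) @^-1` E) * P C.
Proof.
move=> mU mV mC UVC.
pose X : {mfun W >-> (T1 * T2)%type} :=
  HB.pack (fun w => (U w, V w)) (isMeasurableFun.Build _ _ _ _ _ (measurable_fun_pair mU mV)).
have mX : measurable_fun setT X by [].
pose m1 : {measure set (T1 * T2) -> \bar R} := pushforward (mrestr P mC) X.
have PC0 : (0 <= fine (P C))%R by rewrite fine_ge0.
pose m2 : {measure set (T1 * T2) -> \bar R} :=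
  mscale (NngNum PC0) (pushforward P X).
have PCE : (fine (P C))%:E = P C by rewrite fineK// fin_num_measure.
have m2E E : m2 mX E = P ((fun w => (U w, V w)) @^-1` E) * P C.
  by rewrite muleC -PCE.
move=> E mE; rewrite -m2E -[LHS]/(m1 mX E).
apply: (@measure_unique _ R (T1 * T2)%type
  [set A `*` B | A in measurable & B in measurable] (fun=> setT)
  (measurable_prod_measurableType T1 T2)) => //.
- move=> _ _ [A mA [B mB <-]] [A' mA' [B' mB' <-]].
  exists (A `&` A'); first exact: measurableI.
  by exists (B `&` B'); [exact: measurableI|rewrite setXI].
- by move=> _; exists setT => //; exists setT => //; rewrite setXTT.
- by rewrite bigcup_const.
- move=> _ [A mA [B mB <-]]; rewrite m2E; exact: UVC.
- move=> _; rewrite -[ltLHS]/(P (setT `&` C)) setTI.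
  by rewrite -ge0_fin_numE// fin_num_measure.
Qed.

Lemma ge0_integral_indep d1 d2 (T1 : measurableType d1) (T2 : measurableType d2)
    (U : W -> T1) (V : W -> T2) (F : T1 * T2 -> \bar R) :
  measurable_fun setT U -> measurable_fun setT V ->
  (forall A B, measurable A -> measurable B ->
    P (U @^-1` A `&` V @^-1` B) = P (U @^-1` A) * P (V @^-1` B)) ->
  measurable_fun [set: (T1 * T2)%type] F -> (forall x, 0 <= F x) ->
  \int[P]_w F (U w, V w) = \int[P]_w \int[P]_w' F (U w, V w').
Proof.
move=> mU mV UV mF F0.
pose XU : {RV P >-> T1} := HB.pack U (isMeasurableFun.Build _ _ _ _ _ mU).
pose XV : {RV P >-> T2} := HB.pack V (isMeasurableFun.Build _ _ _ _ _ mV).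
pose X : {RV P >-> (T1 * T2)%type} :=
  HB.pack (fun w => (U w, V w)) (isMeasurableFun.Build _ _ _ _ _ (measurable_fun_pair mU mV)).
transitivity (\int[distribution P X]_x F x).
  by rewrite ge0_integral_distribution.
transitivity (\int[distribution P XU \x distribution P XV]_x F x).
  apply: eq_measure_integral => /= A mA _; apply/esym.
  by apply: product_measure_unique => //= A1 A2 mA1 mA2; exact: UV.
rewrite fubini_tonelli1// ge0_integral_distribution//.
- apply: eq_integral => w _ /=; rewrite /fubini_F ge0_integral_distribution//.
  exact: (measurableT_comp mF (pair1_measurable _)).
- exact: measurable_fun_fubini_tonelli_F.
- by move=> y; apply: integral_ge0.
Qed.

End independence.

Lemma measurable_preimage_setT d d' (W : measurableType d)
    (T : measurableType d') (f : W -> T) B :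
  measurable_fun setT f -> measurable B -> measurable (f @^-1` B).
Proof. by move=> mf mB; rewrite -[_ @^-1` _]setTI; exact: mf. Qed.

Section independent_sums.
Context d (W : measurableType d) (R : realType) (P : probability W R).
Variables (n : nat) (u : nat -> W -> R).
Hypothesis measurable_u : forall i, measurable_fun setT (u i).
Hypothesis indep_u : forall A : nat -> set R, (forall i, measurable (A i)) ->
  P (\bigcap_(i in [set i | (0 <= i < n)%N]) (u i @^-1` A i)) =
  (\prod_(0 <= i < n) P (u i @^-1` A i))%E.
Local Open Scope ereal_scope.

Let S k w := (\sum_(i < k) u i w)%R.

Lemma measurable_partial_sum k : measurable_fun setT (S k).
Proof. by apply: measurable_sum. Qed.

(** The invariant of the induction on [k]: the first [k] variables are merged into their sum, and
    the later ones stay in the rule so that they can be merged in turn. *)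
Let prefix_indep k := forall B A, measurable B -> (forall i, measurable (A i)) ->
  P (S k @^-1` B `&` \bigcap_(i in [set i | (k <= i < n)%N]) (u i @^-1` A i)) =
  P (S k @^-1` B) * \prod_(k <= i < n) P (u i @^-1` A i).

Let prefix_indep_split k A1 B1 A : (k < n)%N -> prefix_indep k ->
  measurable A1 -> measurable B1 -> (forall i, measurable (A i)) ->
  P (S k @^-1` A1 `&` u k @^-1` B1 `&`
    \bigcap_(i in [set i | (k < i < n)%N]) (u i @^-1` A i)) =
  P (S k @^-1` A1) * P (u k @^-1` B1) * \prod_(k.+1 <= i < n) P (u i @^-1` A i).
Proof.
move=> kn IHk mA1 mB1 mA; pose A' i := if i == k then B1 else A i.
have mA' i : measurable (A' i) by rewrite /A'; case: ifP.
have A'k : A' k = B1 by rewrite /A' eqxx.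
have A'i i : (k < i)%N -> A' i = A i by move=> ki; rewrite /A' gtn_eqF.
have := IHk A1 A' mA1 mA'; rewrite big_ltn// A'k muleA.
have -> : \prod_(k.+1 <= i < n) P (u i @^-1` A' i) =
    \prod_(k.+1 <= i < n) P (u i @^-1` A i).
  by apply: eq_big_nat => i /andP[ki _]; rewrite A'i.
move=> <-; congr (P _); rewrite -setIA; congr (_ `&` _).
apply/seteqP; split=> [w [uk uA] i /= /andP[ki iN]|w uA].
  rewrite /A'; case: eqP => [->//|/eqP ik]; apply: uA => /=.
  by rewrite iN andbT ltn_neqAle eq_sym ik.
split; first by rewrite -A'k; apply: uA; rewrite /= leqnn.
by move=> i /= /andP[ki iN]; rewrite -A'i//; apply: uA; rewrite /= (ltnW ki).
Qed.

Let pair_indep k A B : (k < n)%N -> prefix_indep k -> measurable A -> measurable B ->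
  P (S k @^-1` A `&` u k @^-1` B) = P (S k @^-1` A) * P (u k @^-1` B).
Proof.
move=> kn IHk mA mB.
have := prefix_indep_split kn IHk mA mB (fun=> measurableT).
rewrite big1 ?mule1 => [<-|i _]; last by rewrite preimage_setT probability_setT.
congr (P _); apply/seteqP; split=> w; last by case.
by move=> ?; split => // i _.
Qed.

Let prefix_indepP k : (k <= n)%N -> prefix_indep k.
Proof.
elim: k => [_|k IH kn] B A mB mA.
  have S0 : S 0 = cst 0%R by apply/funext => w; rewrite /S big_ord0.
  rewrite S0 preimage_cst; case: ifPn => _; last by rewrite set0I measure0 mul0e.
  by rewrite setTI probability_setT mul1e indep_u.
have {}IH := IH (ltnW kn).
set C := \bigcap_(i in _) _.
have mC : measurable C.
  by apply: bigcap_measurableType => // i _; exact: measurable_preimage_setT.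
have PC : P C = \prod_(k.+1 <= i < n) P (u i @^-1` A i).
  have := prefix_indep_split kn IH measurableT measurableT mA.
  by rewrite !preimage_setT !setTI probability_setT !mul1e.
pose E := (fun x : R * R => (x.1 + x.2)%R) @^-1` B.
have mE : measurable E.
  by apply: measurable_preimage_setT => //; apply: measurable_funD.
have -> : S k.+1 @^-1` B = (fun w => (S k w, u k w)) @^-1` E.
  by apply/funext => w; rewrite /S /preimage/= big_ord_recr.
rewrite -PC; apply: prod_preimage_indep => //.
  exact: measurable_partial_sum.
by move=> A1 B1 mA1 mB1; rewrite prefix_indep_split// pair_indep// PC.
Qed.

Lemma indep_partial_sum k A B : (k < n)%N -> measurable A -> measurable B ->
  P (S k @^-1` A `&` u k @^-1` B) = P (S k @^-1` A) * P (u k @^-1` B).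
Proof. by move=> kn; apply: pair_indep => //; exact: prefix_indepP (ltnW kn). Qed.

Lemma integral_partial_sumS k (g : R -> R) : (k < n)%N ->
  measurable_fun setT g -> (forall x, 0 <= g x)%R ->
  \int[P]_w (g (S k.+1 w))%:E =
  \int[P]_w \int[P]_w' (g (S k w + u k w')%R)%:E.
Proof.
move=> kn mg g0.
have := @ge0_integral_indep _ _ _ P _ _ _ _ (S k) (u k)
  (fun x => (g (x.1 + x.2)%R)%:E) (@measurable_partial_sum k) (@measurable_u k).
move=> <- //.
- by apply: eq_integral => w _; rewrite /S big_ord_recr.
- by move=> A B mA mB; exact: indep_partial_sum.
- apply/measurable_EFinP; apply: (measurableT_comp mg).
  exact: measurable_funD.
- by move=> x; rewrite lee_fin.
Qed.

End independent_sums.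

Section has_mean.
Context d (W : measurableType d) (R : realType) (P : probability W R).
Implicit Types (f g : W -> R) (m c : R).

(** Integrability is kept together with a real value, so that moment computations become linear
    arithmetic over [R]. *)
Definition has_mean f m :=
  P.-integrable setT (EFin \o f) /\ (\int[P]_w (f w)%:E)%E = m%:E.

Lemma has_mean_measurable f m : has_mean f m -> measurable_fun setT f.
Proof. by move=> [/integrableP[/measurable_EFinP]]. Qed.

Lemma has_mean_cst c : has_mean (fun=> c) c.
Proof.
split; first exact: finite_measure_integrable_cst.
by rewrite integral_cst// -[RHS]mule1; congr (_ * _)%E; exact: probability_setT.
Qed.

Lemma has_meanD f g m1 m2 :
  has_mean f m1 -> has_mean g m2 -> has_mean (fun w => f w + g w) (m1 + m2).
Proof.
move=> [fi fm] [gi gm]; split.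
  exact: (integrableD measurableT fi gi).
by under eq_integral do rewrite EFinD; rewrite integralD//= fm gm EFinD.
Qed.

Lemma has_meanZ c f m : has_mean f m -> has_mean (fun w => c * f w) (c * m).
Proof.
move=> [fi fm]; split.
  exact: (integrableZl measurableT c fi).
by under eq_integral do rewrite EFinM; rewrite integralZl//= fm EFinM.
Qed.

Lemma has_mean_le f g m1 m2 : has_mean f m1 -> has_mean g m2 ->
  (forall w, f w <= g w) -> m1 <= m2.
Proof.
move=> [fi fm] [gi gm] fg; rewrite -lee_fin -fm -gm; apply: le_integral => //.
by move=> w _; rewrite lee_fin.
Qed.

Lemma has_mean_uniq f m1 m2 : has_mean f m1 -> has_mean f m2 -> m1 = m2.
Proof. by move=> [_ h1] [_]; rewrite h1 => -[]. Qed.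

Lemma has_mean_dominated f g m : measurable_fun setT f -> has_mean g m ->
  (forall w, `|f w| <= g w) -> exists m', has_mean f m'.
Proof.
move=> mf [gi _] fg.
have fi : P.-integrable setT (EFin \o f).
  apply: (le_integrable measurableT _ _ gi); first exact/measurable_EFinP.
  by move=> w _ /=; rewrite lee_fin (le_trans (fg w))// ler_norm.
exists (fine (\int[P]_w (f w)%:E)%E); split => //.
by rewrite fineK//; exact: integrable_fin_num.
Qed.

Lemma has_mean_ge0 f : measurable_fun setT f -> (forall w, 0 <= f w) ->
  (\int[P]_w (f w)%:E < +oo)%E -> exists m, has_mean f m.
Proof.
move=> mf f0 foo.
have fi : P.-integrable setT (EFin \o f).
  apply/integrableP; split; first exact/measurable_EFinP.
  by under eq_integral do rewrite /= ger0_norm//.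
exists (fine (\int[P]_w (f w)%:E)%E); split => //.
by rewrite fineK//; exact: integrable_fin_num.
Qed.

Lemma has_mean_bounded f : measurable_fun setT f ->
  (forall w, 0 <= f w <= 1) -> exists m, has_mean f m.
Proof.
move=> mf f01; apply: (has_mean_dominated mf (has_mean_cst 1)) => w.
by have /andP[f0 f1] := f01 w; rewrite ger0_norm.
Qed.

Lemma has_mean_indic (A : set W) : measurable A ->
  has_mean (fun w => (w \in A)%:R) (fine (P A)).
Proof.
move=> mA; split; first exact: integrable_indic.
by rewrite fineK ?fin_num_measure// integral_indic// setIT.
Qed.

Lemma has_mean_prob (b : pred W) : measurable [set w | b w] ->
  has_mean (fun w => (b w)%:R) (fine (P [set w | b w])).
Proof.
move=> /has_mean_indic; congr has_mean; apply/funext => w.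
by congr (_%:R); case: (boolP (b w)) => bw; [rewrite mem_set|rewrite memNset// /=; apply/negP].
Qed.

End has_mean.

Lemma measurable_fun_lt_cst d (W : measurableType d) (R : realType) (f : W -> R) c :
  measurable_fun setT f -> measurable [set w | f w < c].
Proof.
move=> mf; rewrite (_ : [set w | _] = f @^-1` `]-oo, c[).
  exact: measurable_preimage_setT.
by apply/funext => w; rewrite /preimage/= in_itv.
Qed.

Lemma measurable_fun_le_cst d (W : measurableType d) (R : realType) (f : W -> R) c :
  measurable_fun setT f -> measurable [set w | f w <= c].
Proof.
move=> mf; rewrite (_ : [set w | _] = f @^-1` `]-oo, c]).
  exact: measurable_preimage_setT.
by apply/funext => w; rewrite /preimage/= in_itv.
Qed.

(** * Variance and replacement for independent sums *)

Section independent_means.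
Context d (W : measurableType d) (R : realType) (P : probability W R).
Variables (n : nat) (u : nat -> W -> R).
Hypothesis measurable_u : forall i, measurable_fun setT (u i).
Hypothesis indep_u : forall A : nat -> set R, (forall i, measurable (A i)) ->
  P (\bigcap_(i in [set i | (0 <= i < n)%N]) (u i @^-1` A i)) =
  (\prod_(0 <= i < n) P (u i @^-1` A i))%E.

Let S k w := \sum_(i < k) u i w.

Let mS k : measurable_fun setT (S k). Proof. exact: measurable_partial_sum. Qed.

Let measurable_inner k (g : R -> R) : measurable_fun setT g -> (forall x, 0 <= g x) ->
  measurable_fun setT (fun w => \int[P]_w' (g (S k w + u k w'))%:E)%E.
Proof.
move=> mg g0.
pose F (p : R * W) : \bar R := (g (p.1 + u k p.2))%:E.
have mF : measurable_fun [set: (R * W)%type] F.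
  apply/measurable_EFinP; apply: (measurableT_comp mg).
  by apply: measurable_funD => //; exact: measurableT_comp.
have F0 p : (0 <= F p)%E by rewrite lee_fin.
have H := @measurable_fun_fubini_tonelli_F _ _ _ _ _ P F mF F0.
exact: (measurableT_comp H (mS k)).
Qed.

Lemma mean_partial_sumS_le k (g q : R -> R) m m' : (k < n)%N ->
  measurable_fun setT g -> (forall x, 0 <= g x) ->
  (forall x, \int[P]_w (g (x + u k w))%:E <= (q x)%:E)%E ->
  has_mean P (fun w => g (S k.+1 w)) m -> has_mean P (fun w => q (S k w)) m' -> m <= m'.
Proof.
move=> kn mg g0 gq [_ gm] [qi qm]; rewrite -lee_fin -gm -qm.
rewrite (integral_partial_sumS measurable_u indep_u kn mg g0); apply: ge0_le_integral => //.
- by move=> w _; apply: integral_ge0 => w' _; rewrite lee_fin.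
- exact: measurable_inner.
- by case/integrableP : qi.
Qed.

Lemma mean_partial_sumS_ge k (g q : R -> R) m m' : (k < n)%N ->
  measurable_fun setT g -> (forall x, 0 <= g x) -> (forall x, 0 <= q x) ->
  (forall x, (q x)%:E <= \int[P]_w (g (x + u k w))%:E)%E ->
  has_mean P (fun w => g (S k.+1 w)) m -> has_mean P (fun w => q (S k w)) m' -> m' <= m.
Proof.
move=> kn mg g0 q0 gq [_ gm] [qi qm]; rewrite -lee_fin -gm -qm.
rewrite (integral_partial_sumS measurable_u indep_u kn mg g0); apply: ge0_le_integral => //.
- by move=> w _; rewrite lee_fin.
- by case/integrableP : qi.
- exact: measurable_inner.
Qed.

Lemma has_mean_sum_sqr v k : (k <= n)%N ->
  (forall i, (i < n)%N -> has_mean P (u i) 0) ->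
  (forall i, (i < n)%N -> has_mean P (fun w => u i w ^+ 2) v) ->
  has_mean P (fun w => S k w ^+ 2) (k%:R * v).
Proof.
move=> + u0 u2; elim: k => [_|k IHk kn].
  rewrite mul0r; have := has_mean_cst P 0.
  by congr has_mean; apply/funext => w; rewrite /S big_ord0 expr0n.
have e : (\int[P]_w (S k.+1 w ^+ 2)%:E = (k.+1%:R * v)%:E)%E.
  have mg : measurable_fun setT (fun x : R => x ^+ 2) by exact: measurable_funX.
  rewrite (integral_partial_sumS measurable_u indep_u kn mg) => [|x]; last exact: sqr_ge0.
  have inner x : (\int[P]_w' ((x + u k w') ^+ 2)%:E = (x ^+ 2 + v)%:E)%E.
    have := has_meanD (has_mean_cst P (x ^+ 2))
      (has_meanD (has_meanZ (2 * x) (u0 k kn)) (u2 k kn)).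
    rewrite mulr0 add0r => -[_ <-]; apply: eq_integral => w _; congr _%:E; ring.
  under eq_integral do rewrite inner.
  have [_ ->] := has_meanD (IHk (ltnW kn)) (has_mean_cst P v).
  by rewrite -natr1 mulrDl mul1r.
(* Nonnegativity allowed the integral to be computed first; its finiteness now gives
   integrability. *)
have mf : measurable_fun setT (fun w => S k.+1 w ^+ 2) by exact: measurable_funX.
have [||m hm] := has_mean_ge0 mf (P := P).
- by move=> w; exact: sqr_ge0.
- by rewrite e ltry.
- by split; [exact: hm.1|].
Qed.

Section lindeberg.
Variables (s M B delta : R).
Hypothesis swap : forall k g x m, (k < n)%N -> taylor3 M B g ->
  measurable_fun setT g -> has_mean P (fun w => g (x + u k w)) m ->
  `|m - sign_mean s g x| <= delta.

Lemma measurable_sign_mean (g : R -> R) :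
  measurable_fun setT g -> measurable_fun setT (sign_mean s g).
Proof.
move=> mg; rewrite /sign_mean; apply: measurable_funM => //.
by apply: measurable_funD; apply: (measurableT_comp mg); exact: measurable_funD.
Qed.

Lemma lindeberg_partial_sum k g m : (k <= n)%N -> taylor3 M B g ->
  measurable_fun setT g -> (forall x, 0 <= g x <= 1) ->
  has_mean P (fun w => g (S k w)) m ->
  `|m - iter k (sign_mean s) g 0| <= k%:R * delta.
Proof.
elim: k g m => [|k IHk] g m kn gT mg g01 gm.
  have := has_mean_cst P (g 0); rewrite /= mul0r normr_le0 subr_eq0 => h.
  apply/eqP; apply: (has_mean_uniq gm); move: h.
  by congr has_mean; apply/funext => w; rewrite /S big_ord0.
have mK := measurable_sign_mean mg.
have K01 x : 0 <= sign_mean s g x <= 1.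
  by have := g01 (x + s); have := g01 (x - s); rewrite /sign_mean; lra.
have [m' gm'] : exists m', has_mean P (fun w => sign_mean s g (S k w)) m'.
  by apply: has_mean_bounded => //; exact: measurableT_comp.
have := IHk _ _ (ltnW kn) (taylor3_sign_mean s gT) mK K01 gm'.
rewrite -iterSr.
have inner x : exists2 q, has_mean P (fun w => g (x + u k w)) q &
    `|q - sign_mean s g x| <= delta.
  have [|q gq] := @has_mean_bounded _ _ _ P (fun w => g (x + u k w)) _ (fun w => g01 _).
    by apply: (measurableT_comp mg); exact: measurable_funD.
  by exists q => //; exact: swap gq.
have h1 : m <= m' + delta.
  apply: (mean_partial_sumS_le (q := fun x => sign_mean s g x + delta) kn mg _ _ gm).
  - by move=> x; case/andP : (g01 x).
  - move=> x; have [q [_ ->]] := inner x.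
    by rewrite lee_fin ler_norml; lra.
  - exact: has_meanD gm' (has_mean_cst P delta).
have d0 : 0 <= delta by have [q _] := inner 0; apply: le_trans.
(* [delta] is added to the larger function rather than subtracted from the smaller one, because both
   must stay nonnegative for Tonelli's theorem. *)
have h2 : m' <= m + delta.
  apply: (mean_partial_sumS_ge (g := fun x => g x + delta)
    (q := sign_mean s g) kn _ _ _ _ _ gm').
  - exact: measurable_funD.
  - by move=> x; have := g01 x; lra.
  - by move=> x; case/andP : (K01 x).
  - move=> x; have [q gq] := inner x.
    have [_ ->] := has_meanD gq (has_mean_cst P delta).
    by rewrite lee_fin ler_norml; lra.
  - exact: has_meanD gm (has_mean_cst P delta).
by rewrite -natr1 !ler_norml; lra.
Qed.

End lindeberg.

End independent_means.

(** The first two moments of [v] are exactly those of the sign, so the second-order terms cancel and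
    only cubic remainders are left. *)
Lemma mean_sign_mean d (W : measurableType d) (R : realType) (P : probability W R)
    (v : W -> R) (M B s rho x m : R) g : taylor3 M B g -> 0 <= s ->
  has_mean P v 0 -> has_mean P (fun w => v w ^+ 2) (s ^+ 2) ->
  has_mean P (fun w => `|v w| ^+ 3) rho ->
  has_mean P (fun w => g (x + v w)) m ->
  `|m - sign_mean s g x| <= M * (rho + s ^+ 3).
Proof.
move=> [a [b [bB gT]]] s0 v1 v2 v3 gm; rewrite /sign_mean.
have h1 := gT x s; have h2 := gT x (- s).
rewrite normrN (ger0_norm s0) sqrrN in h1 h2.
have taylor c := has_meanD (has_mean_cst P (g x)) (has_meanD (has_meanZ (a x) v1)
  (has_meanD (has_meanZ (b x) v2) (has_meanZ c v3))).
have h3 : m <= g x + (a x * 0 + (b x * s ^+ 2 + M * rho)).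
  apply: (has_mean_le gm (taylor M)) => w.
  by have := gT x (v w); rewrite ler_norml; lra.
have h4 : g x + (a x * 0 + (b x * s ^+ 2 + - M * rho)) <= m.
  apply: (has_mean_le (taylor (- M)) gm) => w.
  by have := gT x (v w); rewrite ler_norml; lra.
by move: h1 h2; rewrite !ler_norml; lra.
Qed.

Section clt.
Context d (W : measurableType d) (R : realType) (P : probability W R).
Variables (n : nat) (u : nat -> W -> R) (rho : R).
Hypothesis n0 : (0 < n)%N.
Hypothesis measurable_u : forall i, measurable_fun setT (u i).
Hypothesis indep_u : forall A : nat -> set R, (forall i, measurable (A i)) ->
  P (\bigcap_(i in [set i | (0 <= i < n)%N]) (u i @^-1` A i)) =
  (\prod_(0 <= i < n) P (u i @^-1` A i))%E.
Let s : R := (Num.sqrt n%:R)^-1.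
Hypothesis u1 : forall i, (i < n)%N -> has_mean P (u i) 0.
Hypothesis u2 : forall i, (i < n)%N -> has_mean P (fun w => u i w ^+ 2) (s ^+ 2).
Hypothesis u3 : forall i, (i < n)%N -> has_mean P (fun w => `|u i w| ^+ 3) (s ^+ 3 * rho).

Let S w := \sum_(i < n) u i w.
Let mS : measurable_fun setT S. Proof. exact: measurable_partial_sum. Qed.
Let s0 : 0 < s. Proof. by rewrite invr_gt0 sqrtr_gt0 ltr0n. Qed.

Lemma measurable_scaled_step (t h : R) : measurable_fun setT (scaled_step t h).
Proof.
rewrite /scaled_step /smooth_step /pos_part.
have mlin c : measurable_fun setT (fun x : R => ((x - t) / h - c)).
  by apply: measurable_funB => //; apply: measurable_funM => //; exact: measurable_funB.
have mcube c : measurable_fun setT (fun x : R => Num.max ((x - t) / h - c) 0 ^+ 3).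
  by apply: measurable_funX; exact: measurable_maxr.
apply: measurable_funB => //; apply: measurable_funM => //.
apply: measurable_funB => //; apply: measurable_funD; last first.
  by apply: measurable_funM.
apply: measurable_funB; last by apply: measurable_funM.
by have := mcube 0; congr measurable_fun; apply/funext => x; rewrite subr0.
Qed.

(** Each of the [n] exchanges costs [2 / h ^ 3 * s ^ 3 * (1 + rho)], and [n * s ^ 2 = 1] leaves a
    single factor [s]. *)
Let lindeberg t h m : 0 < h -> has_mean P (fun w => scaled_step t h (S w)) m ->
  `|m - iter n (sign_mean s) (scaled_step t h) 0| <= 2 * s * (1 + rho) / h ^+ 3.
Proof.
move=> h0 hm.
have swap k g x m' : (k < n)%N -> taylor3 (2 / h ^+ 3) (1 / h ^+ 2) g ->
    measurable_fun setT g -> has_mean P (fun w => g (x + u k w)) m' ->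
    `|m' - sign_mean s g x| <= 2 / h ^+ 3 * (s ^+ 3 * rho + s ^+ 3).
  move=> kn gT mg; apply: mean_sign_mean gT (ltW s0) _ _ _.
  - exact: u1.
  - exact: u2.
  - exact: u3.
have := lindeberg_partial_sum measurable_u indep_u swap (leqnn n) (taylor3_scaled_step t h0)
  (@measurable_scaled_step t h) (@scaled_step_itv _ t h) hm.
move/le_trans; apply.
have Ns : n%:R * s ^+ 2 = 1.
  by rewrite /s inv_sqrt_sqr mulfV// pnatr_eq0 -lt0n.
rewrite (_ : _ * _ = (n%:R * s ^+ 2) * (2 * s * (1 + rho)) / h ^+ 3); last by ring.
by rewrite Ns mul1r.
Qed.

Let has_mean_step t h : exists m, has_mean P (fun w => scaled_step t h (S w)) m.
Proof.
apply: has_mean_bounded => [|w]; last exact: scaled_step_itv.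
apply: measurableT_comp => //; exact: measurable_scaled_step.
Qed.

Lemma clt_le t h : 0 < h -> fine (P [set w | S w <= t]) <=
  sign_cdf n t + (3 * h + s + 2 * s * (1 + rho) / h ^+ 3).
Proof.
move=> h0; have [m hm] := has_mean_step t h.
have h3 : 0 <= 3 * h by lra.
have := lindeberg h0 hm; rewrite ler_norml => /andP[_].
have := sign_cdfD_le t n0 h3; rewrite -/s.
have : iter n (sign_mean s) (scaled_step t h) 0 <= sign_cdf n (t + 3 * h).
  apply: iter_sign_mean_le => y; apply: (le_trans (scaled_step_le t y h0)).
  by rewrite ler_nat; case: ltP => // /ltW ->.
have : fine (P [set w | S w <= t]) <= m.
  apply: (has_mean_le (has_mean_prob _ _) hm) => [|w].
    exact: measurable_fun_le_cst.
  exact: scaled_step_ge.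
lra.
Qed.

Lemma clt_ge t h : 0 < h ->
  sign_cdf n t - (3 * h + s + 2 * s * (1 + rho) / h ^+ 3) <=
  fine (P [set w | S w < t]).
Proof.
move=> h0; set t' := t - 3 * h; have [m hm] := has_mean_step t' h.
have h3 : 0 <= 3 * h by lra.
have := lindeberg h0 hm; rewrite ler_norml => /andP[+ _].
have := sign_cdfD_le t' n0 h3; rewrite -/s subrK.
have : sign_cdf n t' <= iter n (sign_mean s) (scaled_step t' h) 0.
  by apply: iter_sign_mean_le => y; exact: scaled_step_ge.
have : m <= fine (P [set w | S w < t]).
  apply: (has_mean_le hm (has_mean_prob _ _)) => [|w].
    exact: measurable_fun_lt_cst.
  by apply: (le_trans (scaled_step_le _ _ h0)); rewrite subrK.
lra.
Qed.

End clt.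

(** * Quantiles and the conditional law of the bootstrapped ratio *)

Section quantile.
Context (R : realType) (mu : {measure set R -> \bar R}).
Hypothesis mu1 : mu setT = 1%E.
Implicit Types (t tau c : R).

Let F t := mu `]-oo, t]%classic.

Let F_homo : {homo F : t t' / t <= t' >-> (t <= t')%E}.
Proof.
move=> t t' tt'; apply: le_measure; rewrite ?inE//.
by apply: subset_itvl; rewrite bnd_simp.
Qed.

Let mu_bigcap_ge (A : (set R)^nat) c : (forall i, measurable (A i)) ->
  {homo A : n m / (n <= m)%N >-> (m <= n)%O} -> (forall i, c%:E <= mu (A i))%E ->
  (c%:E <= mu (\bigcap_i A i))%E.
Proof.
move=> mA hA cA.
have H : (mu \o A) i @[i --> \oo] --> mu (\bigcap_i A i).
  apply: nonincreasing_cvg_mu => //; last exact: bigcap_measurableType.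
  apply: (@le_lt_trans _ _ (mu setT)); last by rewrite mu1 ltry.
  by apply: le_measure; rewrite ?inE.
by apply: cvge_to_ge H _; apply: nearW.
Qed.

Let mu_bigcup_le (A : (set R)^nat) c : (forall i, measurable (A i)) ->
  {homo A : n m / (n <= m)%N >-> (n <= m)%O} -> (forall i, mu (A i) <= c%:E)%E ->
  (mu (\bigcup_i A i) <= c%:E)%E.
Proof.
move=> mA hA cA.
have H : (mu \o A) i @[i --> \oo] --> mu (\bigcup_i A i).
  by apply: nondecreasing_cvg_mu => //; exact: bigcup_measurable.
by apply: cvge_to_le H _; apply: nearW.
Qed.

Lemma mu_rays_left t c : (forall k : nat, mu `]-oo, (t - k.+1%:R^-1)%R]%classic <= c%:E)%E ->
  (mu `]-oo, t[%classic <= c%:E)%E.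
Proof.
move=> Fc; have -> : `]-oo, t[%classic = \bigcup_k `]-oo, t - k.+1%:R^-1]%classic.
  apply/seteqP; split=> x /=; rewrite in_itv/=.
    move=> /ltr_add_invr[k xk]; exists k => //=.
    by rewrite in_itv/= lerBrDr ltW.
  move=> [k _] /=; rewrite in_itv/= => /le_lt_trans; apply.
  by rewrite ltrBlDr ltrDl.
apply: mu_bigcup_le => // m n mn; apply/subsetPset.
apply: subset_itvl; rewrite bnd_simp lerD2l lerN2 lef_pV2 ?posrE//.
by rewrite ler_nat.
Qed.

Let F_lt tau : 0 < tau -> exists t, (F t < tau%:E)%E.
Proof.
move=> tau0; apply: contrapT => /forallNP nF.
have := @mu_bigcap_ge (fun k => `]-oo, (- k%:R)]%classic) tau (fun=> measurable_itv _).
rewrite (_ : \bigcap_k _ = set0); last first.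
  rewrite -subset0 => x xk; have := xk (Num.truncn (- x)).+1 I.
  rewrite /= in_itv/= lerNr => /(lt_le_trans (truncnS_gt (- x))); rewrite ltxx//.
rewrite measure0 lee_fin => H; suff : tau <= 0 by lra.
apply: H => [m n mn|k]; last by rewrite leNgt; apply/negP/nF.
by apply/subsetPset/subset_itvl; rewrite bnd_simp lerN2 ler_nat.
Qed.

Let F_ge tau : tau < 1 -> exists t, (tau%:E <= F t)%E.
Proof.
move=> tau1; apply: contrapT => /forallNP nF.
have := @mu_bigcup_le (fun k => `]-oo, k%:R]%classic) tau (fun=> measurable_itv _).
rewrite (_ : \bigcup_k _ = setT); last first.
  rewrite -subTset => x _; exists (Num.truncn x).+1 => //=.
  by rewrite in_itv/= ltW// truncnS_gt.
rewrite mu1 lee_fin => H; suff : 1 <= tau by lra.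
apply: H => [m n mn|k]; last by rewrite ltW// ltNge; apply/negP/nF.
by apply/subsetPset/subset_itvl; rewrite bnd_simp ler_nat.
Qed.

Let F_right t tau : (forall e : R, 0 < e -> (tau%:E <= F (t + e)%R)%E) -> (tau%:E <= F t)%E.
Proof.
move=> tF; rewrite /F.
have -> : `]-oo, t]%classic = \bigcap_k `]-oo, t + k.+1%:R^-1]%classic.
  apply/seteqP; split=> x /=; rewrite in_itv/=.
    by move=> xt k _ /=; rewrite in_itv/= (le_trans xt)// lerDl.
  move=> xk; rewrite leNgt; apply/negP => /ltr_add_invr[k].
  by rewrite ltNge; have := xk k I; rewrite /= in_itv/= => ->.
apply: mu_bigcap_ge => [//|m n mn|k]; last exact: tF.
apply/subsetPset/subset_itvl; rewrite bnd_simp lerD2l lef_pV2 ?posrE//.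
by rewrite ler_nat.
Qed.

Let Q tau := [set t : R | (tau%:E <= mu `]-oo, t]%classic)%E].

Let Q0 tau : tau < 1 -> Q tau !=set0.
Proof. by move=> /F_ge. Qed.

Let Qlb tau : 0 < tau -> has_lbound (Q tau).
Proof.
move=> /F_lt[t Ft]; exists t => x Qx; rewrite leNgt; apply/negP => xt.
have := le_lt_trans (F_homo (ltW xt)) Ft.
by rewrite ltNge; move/negP; exact.
Qed.

(** For [0 < tau < 1] the set defining the quantile is nonempty and bounded below, so [inf] is not a
    default value; right continuity of the distribution function puts the infimum in the set. *)
Lemma quantile_le tau t : 0 < tau < 1 ->
  (quantile mu tau <= t) = (tau%:E <= mu `]-oo, t]%classic)%E.
Proof.
move=> /andP[tau0 tau1]; apply/idP/idP => [qt|]; last first.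
  by move=> Qt; apply: ge_inf Qt; exact: Qlb.
apply: F_right => e e0.
have [x Qx xq] := inf_adherent e0 (conj (Q0 tau1) (Qlb tau0)).
apply: (le_trans Qx); apply: F_homo; apply/ltW/(lt_le_trans xq).
by rewrite lerD2r.
Qed.

(** The right-hand side is a countable condition, which later makes the coverage event measurable.
    It is implied by a left limit below [tau] and implies a left limit at most [tau]. *)
Lemma le_quantile tau t : 0 < tau < 1 ->
  t <= quantile mu tau <-> forall k : nat, (mu `]-oo, (t - k.+1%:R^-1)%R]%classic < tau%:E)%E.
Proof.
move=> /andP[tau0 tau1]; split=> [tq k|tk].
  rewrite ltNge; apply/negP => Qk; have := ge_inf (Qlb tau0) Qk.
  rewrite -/(quantile mu tau) => qk.
  have : t - k.+1%:R^-1 < t by rewrite ltrBlDr ltrDl.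
  by rewrite ltNge (le_trans tq).
apply: lb_le_inf (Q0 tau1) _ => x Qx; rewrite leNgt; apply/negP => /ltr_add_invr[k xk].
have := tk k; rewrite ltNge => /negP; apply; apply: (le_trans Qx).
by apply: F_homo; rewrite lerBrDr ltW.
Qed.

End quantile.

Lemma measurable_natr_bool d (W : measurableType d) (R : realType) (b : pred W) :
  measurable [set w | b w] -> measurable_fun setT (fun w => (b w)%:R : R).
Proof.
move=> mb; have := @measurable_indic _ W R setT _ mb; congr measurable_fun.
apply/funext => w; rewrite indicE; congr (_%:R).
by case: (boolP (b w)) => bw; [rewrite mem_set|rewrite memNset// /=; apply/negP].
Qed.

(** * Conditional laws given the sample *)

Section bootstrap_law.
Context d d' (W : measurableType d) (E : measurableType d') (R : realType).
Variables (P : probability W R) (S : W -> E).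
Hypothesis mS : measurable_fun setT S.

Lemma has_mean_sum (I : finType) (f : I -> W -> R) (m : I -> R) :
  (forall i, has_mean P (f i) (m i)) ->
  has_mean P (fun w => \sum_i f i w) (\sum_i m i).
Proof.
move=> fm; rewrite (_ : (fun w => _) = \sum_i f i); last first.
  by apply/funext => w; rewrite fct_sumE.
elim/big_rec2 : _ => [|i x F _ hF]; first exact: has_mean_cst.
exact: has_meanD.
Qed.

Let measurable_preS (b : pred E) : measurable [set s | b s] ->
  measurable [set w | b (S w)].
Proof. by move=> mb; exact: (measurable_preimage_setT mS mb). Qed.

Section conditional.
Variables (T : {RV P >-> R}) (k : R.-pker E ~> R).
Hypothesis kT : conditional_distribution S T k.

Lemma prob_kernel_itv s A : measurable A -> 0 <= fine (k s A) <= 1.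
Proof.
move=> mA; have k1 : (k s A <= 1)%E.
  by rewrite -(prob_kernel (s := k) s) le_measure ?inE.
rewrite fine_ge0//= -lee_fin fineK// ge0_fin_numE//.
by rewrite (le_lt_trans k1)// ltry.
Qed.

Lemma prob_kernel_fineK s A : measurable A -> (fine (k s A))%:E = k s A.
Proof.
move=> mA; rewrite fineK// ge0_fin_numE// (@le_lt_trans _ _ 1%E) ?ltry//.
by rewrite -(prob_kernel (s := k) s) le_measure ?inE.
Qed.

Lemma measurable_fine_kernel A : measurable A ->
  measurable_fun setT (fun s => fine (k s A)).
Proof.
move=> mA; apply: (measurableT_comp (@fine_measurable R setT measurableT)) => //.
exact: measurable_kernel.
Qed.

Lemma has_mean_conditional (b : pred E) A : measurable [set s | b s] -> measurable A ->
  has_mean P (fun w => (b (S w))%:R * fine (k (S w) A))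
    (fine (P ([set w | b (S w)] `&` T @^-1` A))).
Proof.
move=> mb mA; have mbS := measurable_preS mb.
have [||m hm] := @has_mean_bounded _ _ _ P (fun w => (b (S w))%:R * fine (k (S w) A)).
- apply: measurable_funM; first exact: has_mean_measurable (has_mean_prob P mbS).
  exact: (measurableT_comp (measurable_fine_kernel mA)).
- move=> w; have := prob_kernel_itv (S w) mA.
  by case: (b (S w)); rewrite ?mul1r ?mul0r ?lexx ?ler01.
split; first exact: hm.1.
rewrite fineK; last by apply: fin_num_measure; apply: measurableI => //;
  exact: measurable_preimage_setT.
rewrite -[RHS]/(P (S @^-1` [set s | b s] `&` T @^-1` A)) kT//.
rewrite [RHS]integral_mkcond; apply: eq_integral => w _.
rewrite patchE; case: ifPn; rewrite ?inE ?notin_setE /preimage/= => bw.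
  by rewrite bw mul1r prob_kernel_fineK.
by rewrite (negbTE (introN idP bw)) mul0r.
Qed.

End conditional.

Section draws.
Variables (n : nat) (J : 'I_n -> W -> 'I_n).
Hypothesis JS : uniform_draws P S J.
Implicit Types (L : {ffun 'I_n -> 'I_n} -> pred E).

Let Jf w : {ffun 'I_n -> 'I_n} := [ffun i => J i w].

(* All the maps [f] are equally likely draws, so this is the conditional
   probability of [L] given that the sample is [s]. *)
Definition draw_freq L s : R :=
  (n%:R ^+ n)^-1 * \sum_(f : {ffun 'I_n -> 'I_n}) (L f s)%:R.

(** The event is split by the map [f] that the draws realize; each map has probability [n ^ - n]
    independently of the sample. Equality of means against every [b] is what identifies [draw_freq]
    as a conditional probability. *)
Lemma has_mean_draws (b : pred E) L : measurable [set s | b s] ->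
  (forall f, measurable [set s | L f s]) ->
  exists2 m, has_mean P (fun w => (b (S w) && L (Jf w) (S w))%:R) m &
    has_mean P (fun w => (b (S w))%:R * draw_freq L (S w)) m.
Proof.
move=> mb mL.
have mbL f : measurable [set s | b s && L f s].
  rewrite (_ : [set s | _] = [set s | b s] `&` [set s | L f s]).
    exact: measurableI.
  by apply/seteqP; split=> s /= => [/andP//|[-> ->]].
pose q f := fine (P [set w | b (S w) && L f (S w)]).
have hq f : has_mean P (fun w => (b (S w) && L f (S w))%:R) (q f).
  exact: (has_mean_prob P (measurable_preS (mbL f))).
exists ((n%:R ^+ n)^-1 * \sum_f q f); last first.
  have := has_meanZ (n%:R ^+ n)^-1 (has_mean_sum hq).
  congr has_mean; apply/funext => w; rewrite /draw_freq mulrCA; congr (_ * _).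
  by rewrite mulr_sumr; apply: eq_bigr => f _; rewrite -natrM mulnb.
have hqJ f : has_mean P (fun w => (b (S w) && L f (S w) && (Jf w == f))%:R)
    ((n%:R ^+ n)^-1 * q f).
  have e : [set w | b (S w) && L f (S w) && (Jf w == f)] =
      S @^-1` [set s | b s && L f s] `&`
      \bigcap_(i in [set: 'I_n]) (J i @^-1` [set f i]).
    apply/seteqP; split=> w /=.
      by move=> /andP[bL /eqP fe]; split=> [//|i _]; rewrite /= -fe ffunE.
    move=> [-> JF]; apply/eqP/ffunP => i; rewrite ffunE.
    exact: JF.
  have mJ : measurable [set w | b (S w) && L f (S w) && (Jf w == f)].
    rewrite e; apply: measurableI; first exact: measurable_preimage_setT.
    by apply: fin_bigcap_measurable => // i _; exact: JS.1.
  have := has_mean_prob P mJ; congr has_mean.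
  rewrite e (JS.2 _ _ (mbL f)) -[P _](@fineK R); last first.
    by apply: fin_num_measure; exact: measurable_preimage_setT.
  by rewrite prodEFin -EFinM/= prodr_const card_ord exprVn mulrC.
have := has_mean_sum hqJ; rewrite -mulr_sumr; congr has_mean.
apply/funext => w; rewrite (bigD1 (Jf w))//= eqxx andbT big1 ?addr0// => f fJ.
by rewrite eq_sym (negbTE fJ) andbF.
Qed.

Lemma measurable_draw_freq L : (forall f, measurable [set s | L f s]) ->
  measurable_fun setT (draw_freq L).
Proof.
move=> mL; apply: measurable_funM => //; apply: measurable_sum => f.
exact: measurable_natr_bool.
Qed.

End draws.

End bootstrap_law.

(** * Coverage at a fixed sample size *)

Lemma fine_probD_le d (W : measurableType d) (R : realType) (P : probability W R)
    (A B C : set W) : measurable A -> measurable B -> measurable C ->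
  A `<=` B `|` C -> fine (P A) <= fine (P B) + fine (P C).
Proof.
move=> mA mB mC ABC.
apply: (has_mean_le (has_mean_indic P mA)
  (has_meanD (has_mean_indic P mB) (has_mean_indic P mC))) => w.
rewrite -natrD ler_nat; have [/set_mem/ABC[]|//] := boolP (w \in A).
  by move/mem_set => ->.
by move/mem_set => ->; rewrite addn1.
Qed.

(* Integrating both sides over the event whose probability is bounded: there they
   differ by at least [eps], while their integrals differ by at most [p]. *)
Lemma kernel_draw_freq_close d d' (W : measurableType d) (E : measurableType d')
    (R : realType) (P : probability W R) (S : W -> E) (T : {RV P >-> R})
    (k : R.-pker E ~> R) (n : nat) (J : 'I_n -> W -> 'I_n)
    (L Lbad : {ffun 'I_n -> 'I_n} -> pred E) (A : set R) (p eps : R) :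
  measurable_fun setT S -> conditional_distribution S T k -> uniform_draws P S J ->
  (forall f, measurable [set s | L f s]) ->
  (forall f, measurable [set s | Lbad f s]) -> measurable A ->
  (forall w, ~~ Lbad [ffun i => J i w] (S w) ->
    (T w \in A) = L [ffun i => J i w] (S w)) ->
  has_mean P (fun w => draw_freq R Lbad (S w)) p -> 0 < eps ->
  fine (P [set w | draw_freq R L (S w) + eps <= fine (k (S w) A)]) <= p / eps /\
  fine (P [set w | fine (k (S w) A) + eps <= draw_freq R L (S w)]) <= p / eps.
Proof.
move=> mS kT JS mL mLb mA TL Hp eps0.
have key (b : pred E) : measurable [set s | b s] -> exists m1 m2,
    [/\ has_mean P (fun w => (b (S w))%:R * fine (k (S w) A)) m1,
        has_mean P (fun w => (b (S w))%:R * draw_freq R L (S w)) m2,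
        m1 <= m2 + p & m2 <= m1 + p].
  move=> mb; have hm1 := has_mean_conditional mS kT mb mA.
  have [m2 hJ hm2] := has_mean_draws mS JS mb mL.
  have mT : measurable [set s : E | xpredT s].
    by rewrite (_ : [set s | _] = setT)//; apply/seteqP.
  have [p' hbad hp'] := has_mean_draws mS JS mT mLb.
  have {hp'}pp' : p' = p.
    apply: (has_mean_uniq hp'); move: Hp; congr has_mean.
    by apply/funext => w; rewrite mul1r.
  rewrite {p'}pp' in hbad.
  have mbS : measurable [set w | b (S w)] by exact: (measurable_preimage_setT mS mb).
  have mbT : measurable ([set w | b (S w)] `&` T @^-1` A).
    by apply: measurableI => //; exact: measurable_preimage_setT.
  have hT := has_mean_indic P mbT.
  have inE' w : (w \in [set w | b (S w)] `&` T @^-1` A) = b (S w) && (T w \in A).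
    have -> : (w \in [set w | b (S w)] `&` T @^-1` A) =
        `[< b (S w) /\ A (T w) >] by apply/idP/asboolP => [/set_mem|/mem_set].
    by apply/asboolP/idP => [[bw /mem_set Tw]|/andP[bw /set_mem Tw]] //; exact/andP.
  exists (fine (P ([set w | b (S w)] `&` T @^-1` A))), m2; split => //.
    apply: (has_mean_le hT (has_meanD hJ hbad)) => w.
    rewrite inE' -natrD ler_nat /=; case: (boolP (Lbad _ _)) => [_|/TL ->].
      by rewrite addn1 (leq_trans (leq_b1 _)).
    by rewrite addn0.
  apply: (has_mean_le hJ (has_meanD hT hbad)) => w.
  rewrite inE' -natrD ler_nat /=; case: (boolP (Lbad _ _)) => [_|/TL ->].
    by rewrite addn1 (leq_trans (leq_b1 _)).
  by rewrite addn0.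
have mk := measurable_fine_kernel k mA; have mf := @measurable_draw_freq _ E R _ _ mL.
have mle (f g : E -> R) : measurable_fun setT f -> measurable_fun setT g ->
    measurable [set s | f s + eps <= g s].
  move=> mf' mg'; rewrite (_ : [set s | _] = [set s | f s + eps - g s <= 0]).
    apply: measurable_fun_le_cst; apply: measurable_funB => //.
    exact: measurable_funD.
  by apply/funext => s /=; rewrite subr_le0.
split; rewrite ler_pdivlMr// mulrC.
  pose b s := draw_freq R L s + eps <= fine (k s A).
  have mb : measurable [set s | b s] by exact: mle.
  have [m1 [m2 [h1 h2 m12 _]]] := key b mb.
  have hb := has_meanZ eps (has_mean_prob P (measurable_preimage_setT mS mb)).
  suff : m2 + eps * fine (P [set w | b (S w)]) <= m1 by rewrite /b; lra.
  apply: (has_mean_le (has_meanD h2 hb) h1) => w; case: (boolP (b (S w))).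
    by rewrite /b !mul1r mulr1.
  by rewrite !mul0r mulr0 addr0.
pose b s := fine (k s A) + eps <= draw_freq R L s.
have mb : measurable [set s | b s] by exact: mle.
have [m1 [m2 [h1 h2 _ m12]]] := key b mb.
have hb := has_meanZ eps (has_mean_prob P (measurable_preimage_setT mS mb)).
suff : m1 + eps * fine (P [set w | b (S w)]) <= m2 by rewrite /b; lra.
apply: (has_mean_le (has_meanD h1 hb) h2) => w; case: (boolP (b (S w))).
  by rewrite /b !mul1r mulr1.
by rewrite !mul0r mulr0 addr0.
Qed.

(** An approximate probability integral transform, with [G] for [sign_cdf n]. If [G c1] and [G c2]
    are near [lo] and [hi], the event is nearly [- c2 < T < - c1], of probability near
    [G (- c1) - G (- c2)] and, by symmetry, near [hi - lo]. The last two hypotheses keep the levels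
    to be inverted inside (0, 1). *)
Lemma coverage_bounds d (W : measurableType d) (R : realType) (P : probability W R)
    (n : nat) (T : W -> R) (lo hi eta0 h eta beta : R) (Ev bad : set W) :
  (0 < n)%N -> 0 < h -> measurable_fun setT T -> measurable Ev -> measurable bad ->
  (forall t, fine (P [set w | T w <= t]) <= sign_cdf n t + eta) ->
  (forall t, sign_cdf n t - eta <= fine (P [set w | T w < t])) ->
  fine (P bad) <= beta ->
  (forall w, Ev w -> ~ bad w ->
    lo - eta0 <= sign_cdf n (- T w) <= hi + eta0) ->
  (forall w, ~ bad w -> lo + eta0 <= sign_cdf n (- T w) ->
    sign_cdf n (- T w) < hi - eta0 -> Ev w) ->
  0 <= eta0 -> lo < hi ->
  eta0 + 2 * (h + (Num.sqrt n%:R)^-1) < lo ->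
  hi < 1 - (eta0 + 2 * (h + (Num.sqrt n%:R)^-1)) ->
  `|fine (P Ev) - (hi - lo)| <=
  2 * eta0 + 5 * (h + (Num.sqrt n%:R)^-1) + 2 * eta + beta.
Proof.
move=> n0 h0 mT mEv mbad Tle Tge Pbad up down eta00 lohi lo_gt hi_lt.
have s0 : 0 < (Num.sqrt n%:R)^-1 :> R by rewrite invr_gt0 sqrtr_gt0 ltr0n.
have Q u := @sign_cdf_quantile R n h u n0 h0.
have Gle c := @sign_cdfN_le R n c h n0 h0.
have Gge c := @sign_cdfN_ge R n c.
set om := h + _ in lo_gt hi_lt Q Gle *; have om0 : 0 < om by rewrite addr_gt0.
have mle t : measurable [set w | T w <= t] by exact: measurable_fun_le_cst.
have mlt t : measurable [set w | T w < t] by exact: measurable_fun_lt_cst.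
have anti t t' : sign_cdf n t < sign_cdf n t' -> t < t'.
  by move=> tt; rewrite ltNge; apply/negP => /(sign_cdf_homo n); rewrite leNgt tt.
have mU (A B : set W) : measurable A -> measurable B -> measurable (A `|` B).
  by move=> mA mB; exact: measurableU.
rewrite ler_norml; apply/andP; split.
  have [|c1 /andP[c1l c1u]] := Q (lo + eta0); first by apply/andP; split; lra.
  (* [sign_cdf n c2] may exceed its level by [om]; the shift by [2 * om] keeps it strictly below
     [hi - eta0], as [down] requires. *)
  have [|c2 /andP[c2l c2u]] := Q (hi - eta0 - 2 * om).
    by apply/andP; split; lra.
  have sub : [set w | T w < - c1] `<=` (Ev `|` bad) `|` [set w | T w <= - c2].
    move=> w /= Tc1; case: (lerP (T w) (- c2)) => Tc2; first by right.
    left; case: (pselect (bad w)) => [|nb]; [by right|left; apply: down => //].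
      by apply: (le_trans c1l); apply: sign_cdf_homo; rewrite lerNr ltW.
    have : sign_cdf n (- T w) <= sign_cdf n c2.
      by apply: sign_cdf_homo; rewrite lerNl ltW.
    lra.
  have := fine_probD_le P (mlt _) (mU _ _ (mU _ _ mEv mbad) (mle _)) measurable0
    (subset_trans sub (@subsetUl _ _ set0)).
  have := fine_probD_le P (mU _ _ (mU _ _ mEv mbad) (mle (- c2)))
    (mU _ _ mEv mbad) (mle (- c2)) (@subset_refl _ _).
  have := fine_probD_le P (mU _ _ mEv mbad) mEv mbad (@subset_refl _ _).
  rewrite measure0/=.
  have := Tge (- c1); have := Tle (- c2).
  have := Gge c1; have := Gle c2; lra.
have [|c1 /andP[c1l c1u]] := Q (lo - eta0 - 2 * om); first by apply/andP; split; lra.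
have [|c2 /andP[c2l c2u]] := Q (hi + eta0 + om); first by apply/andP; split; lra.
have sub : Ev `|` [set w | T w < - c2] `<=` [set w | T w <= - c1] `|` bad.
  move=> w [Ew|/= Tc2].
    case: (pselect (bad w)) => [|nb]; [by right|left => /=].
    have /andP[U1 U2] := up w Ew nb.
    by rewrite lerNr ltW//; apply: anti; lra.
  left => /=; rewrite (le_trans (ltW Tc2))// lerN2 ltW//; apply: anti; lra.
have disj : Ev `&` [set w | T w < - c2] `<=` bad.
  move=> w [Ew /= Tc2]; apply: contrapT => nb.
  have /andP[U1 U2] := up w Ew nb.
  have : sign_cdf n c2 <= sign_cdf n (- T w) by apply: sign_cdf_homo; rewrite lerNr ltW.
  lra.
(* Counting pointwise pays for [bad] only once: a point of both sets on the left lies in [bad] and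
   also satisfies [T w <= - c1]. *)
have h1 : fine (P Ev) + fine (P [set w | T w < - c2]) <=
    fine (P [set w | T w <= - c1]) + fine (P bad).
  apply: (has_mean_le (has_meanD (has_mean_indic P mEv) (has_mean_indic P (mlt _)))
    (has_meanD (has_mean_indic P (mle _)) (has_mean_indic P mbad))) => w.
  rewrite -!natrD ler_nat.
  have [/set_mem Ew|_] := boolP (w \in Ev); have [/set_mem Tw|_] := boolP (w \in [set w | T w < - c2]).
  - have /mem_set -> := disj w (conj Ew Tw).
    rewrite mem_set//=; rewrite (le_trans (ltW Tw))// lerN2 ltW//; apply: anti; lra.
  - by have [/mem_set->|/mem_set->] := sub w (or_introl Ew); rewrite ?addn1// addn0.
  - by have [/mem_set->|/mem_set->] := sub w (or_intror Tw); rewrite ?addn1// addn0.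
  - by [].
have := Tge (- c2); have := Tle (- c1).
have := Gge c2; have := Gle c1; lra.
Qed.

(** * Sums over an i.i.d. sample *)

Section iid_sums.
Context d d' (W : measurableType d) (E : measurableType d') (R : realType).
Context (P : probability W R) (mu : probability E R) (n : nat).
Variable Z : 'I_n.+1 -> {RV P >-> E}.
Hypothesis Z_iid : iid mu Z.

Lemma iid_has_mean (f : E -> R) m i : has_mean mu f m ->
  has_mean P (fun w => f (Z i w)) m.
Proof.
move=> [fi fm]; have mf : measurable_fun setT f := has_mean_measurable (conj fi fm).
have mfZ : measurable_fun setT (fun w => f (Z i w)) by exact: measurableT_comp.
have dist (g : E -> \bar R) : measurable_fun setT g -> (forall z, 0 <= g z)%E ->
    (\int[mu]_z g z = \int[P]_w g (Z i w))%E.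
  move=> mg g0; rewrite -[RHS]/(\int[P]_w (g \o Z i) w)%E -ge0_integral_distribution//.
  apply: eq_measure_integral => A mA _; apply/esym; exact: Z_iid.1.
have mfE : measurable_fun setT (EFin \o f) by exact/measurable_EFinP.
have fiP : P.-integrable setT (EFin \o (fun w => f (Z i w))).
  apply/integrableP; split; first exact/measurable_EFinP.
  rewrite -(dist (fun z => `|(f z)%:E|%E))//; last exact: measurableT_comp.
  by case/integrableP : fi.
split => //; rewrite -fm.
rewrite -[LHS]/(\int[P]_w ((EFin \o f) \o Z i) w)%E -integral_distribution//.
apply: eq_measure_integral => A mA _; exact: Z_iid.1.
Qed.

Lemma has_mean_iid (f : E -> R) m i : measurable_fun setT f ->
  has_mean P (fun w => f (Z i w)) m -> has_mean mu f m.
Proof.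
move=> mf fP.
have mfE : measurable_fun setT (EFin \o f) by exact/measurable_EFinP.
have dist (g : E -> \bar R) : measurable_fun setT g -> (forall z, 0 <= g z)%E ->
    (\int[mu]_z g z = \int[P]_w g (Z i w))%E.
  move=> mg g0; rewrite -[RHS]/(\int[P]_w (g \o Z i) w)%E -ge0_integral_distribution//.
  apply: eq_measure_integral => A mA _; apply/esym; exact: Z_iid.1.
have fi : mu.-integrable setT (EFin \o f).
  apply/integrableP; split => //.
  rewrite (dist (fun z => `|(f z)%:E|%E))//; last exact: measurableT_comp.
  by case: fP => /integrableP[].
have fmu : has_mean mu f (fine (\int[mu]_z (f z)%:E)%E).
  by split => //; rewrite fineK//; exact: integrable_fin_num.
by rewrite (has_mean_uniq fP (iid_has_mean i fmu)).
Qed.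

(** [inord] extends the family to all natural indices; beyond [n] it repeats the index 0, which the
    product rule over indices below [n.+1] never sees. *)
Let u (f : E -> R) i w := f (Z (inord i) w).

Let mu_ f i : measurable_fun setT f -> measurable_fun setT (u f i).
Proof. by move=> mf; exact: measurableT_comp. Qed.

Let u_indep f : measurable_fun setT f ->
  forall A : nat -> set R, (forall i, measurable (A i)) ->
  P (\bigcap_(i in [set i | (0 <= i < n.+1)%N]) (u f i @^-1` A i)) =
  (\prod_(0 <= i < n.+1) P (u f i @^-1` A i))%E.
Proof.
move=> mf A mA; rewrite big_mkord.
have := Z_iid.2 (fun i => f @^-1` A i)
  (fun i => measurable_preimage_setT mf (mA i)).
rewrite (eq_bigr (fun i : 'I_n.+1 => P (u f i @^-1` A i))) => [<-|i _]; last first.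
  by rewrite /u inord_val.
congr (P _); apply/seteqP; split=> w Aw i /=.
  by move=> _; have := Aw i (ltn_ord i); rewrite /u /= inord_val.
by move=> iN; have := Aw (Ordinal iN) I; rewrite /u /=; congr (A _ (f (Z _ w)));
  apply/val_inj; rewrite /= inordK.
Qed.

Let sum_u f w : \sum_(i < n.+1) u f i w = \sum_(i < n.+1) f (Z i w).
Proof. by apply: eq_bigr => i _; rewrite /u inord_val. Qed.

Lemma iid_sum_sqr (f : E -> R) v : has_mean mu f 0 ->
  has_mean mu (fun z => f z ^+ 2) v ->
  has_mean P (fun w => (\sum_i f (Z i w)) ^+ 2) (n.+1%:R * v).
Proof.
move=> f1 f2; have mf := has_mean_measurable f1.
have := @has_mean_sum_sqr _ _ _ P n.+1 (u f) (fun i => mu_ i mf) (u_indep mf) v n.+1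
  (leqnn _) (fun i _ => iid_has_mean _ f1) (fun i _ => iid_has_mean _ f2).
by congr has_mean; apply/funext => w; rewrite sum_u.
Qed.

Let s : R := (Num.sqrt n.+1%:R)^-1.

Let s0 : 0 < s. Proof. by rewrite invr_gt0 sqrtr_gt0 ltr0n. Qed.

Lemma iid_clt (f : E -> R) rho h : has_mean mu f 0 ->
  has_mean mu (fun z => f z ^+ 2) 1 -> has_mean mu (fun z => `|f z| ^+ 3) rho ->
  0 < h -> forall t,
  fine (P [set w | s * (\sum_i f (Z i w)) <= t]) <=
    sign_cdf n.+1 t + (3 * h + s + 2 * s * (1 + rho) / h ^+ 3) /\
  sign_cdf n.+1 t - (3 * h + s + 2 * s * (1 + rho) / h ^+ 3) <=
    fine (P [set w | s * (\sum_i f (Z i w)) < t]).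
Proof.
move=> f1 f2 f3 h0 t; pose g z := s * f z.
have mg : measurable_fun setT g := has_mean_measurable (has_meanZ s f1).
have g1 i : (i < n.+1)%N -> has_mean P (u g i) 0.
  move=> _; rewrite -(mulr0 s); exact: has_meanZ (iid_has_mean _ f1).
have g2 i : (i < n.+1)%N -> has_mean P (fun w => u g i w ^+ 2) (s ^+ 2).
  move=> _; rewrite -(mulr1 (s ^+ 2)).
  have := has_meanZ (s ^+ 2) (iid_has_mean (inord i) f2).
  by congr has_mean; apply/funext => w; rewrite exprMn.
have g3 i : (i < n.+1)%N -> has_mean P (fun w => `|u g i w| ^+ 3) (s ^+ 3 * rho).
  move=> _; have := has_meanZ (s ^+ 3) (iid_has_mean (inord i) f3).
  by congr has_mean; apply/funext => w; rewrite /u normrM exprMn (ger0_norm (ltW s0)).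
have sumE w : \sum_(i < n.+1) u g i w = s * \sum_i f (Z i w).
  by rewrite sum_u mulr_sumr.
have := @clt_le _ _ _ P n.+1 (u g) rho isT (fun i => mu_ i mg) (u_indep mg) g1 g2 g3 t h h0.
have := @clt_ge _ _ _ P n.+1 (u g) rho isT (fun i => mu_ i mg) (u_indep mg) g1 g2 g3 t h h0.
have -> : [set w | (fun w0 => \sum_(i < n.+1) u g i w0) w < t] =
    [set w | s * \sum_i f (Z i w) < t].
  by apply/funext => w /=; rewrite sumE.
have -> : [set w | (fun w0 => \sum_(i < n.+1) u g i w0) w <= t] =
    [set w | s * \sum_i f (Z i w) <= t].
  by apply/funext => w /=; rewrite sumE.
by [].
Qed.

End iid_sums.

(** Chebyshev's inequality for the draws. Centering at a number [m], later the true mean of [Y],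
    rather than at the empirical mean makes the expectation of the bound over the sample
    explicit. *)
Lemma draw_freq_nonpos_le (R : realType) (n : nat) (y : 'I_n -> R) (m : R) :
  (0 < n)%N -> 0 < m ->
  (n%:R ^+ n)^-1 * \sum_(f : {ffun 'I_n -> 'I_n}) (\sum_i y (f i) <= 0)%R%:R <=
  ((\sum_j (y j - m)) ^+ 2 + \sum_j (y j - m) ^+ 2) / (n%:R * m) ^+ 2.
Proof.
move=> n0 m0; pose v j := y j - m; have nR0 : 0 < n%:R :> R by rewrite ltr0n.
have nm0 : 0 < (n%:R * m) ^+ 2 by rewrite exprn_gt0// mulr_gt0.
rewrite ler_pdivlMr//.
apply: (@le_trans _ _ (iter n (emp_step v) (fun x => x ^+ 2) 0)).
  rewrite iter_emp_stepE -mulrA ler_wpM2l ?invr_ge0 ?exprn_ge0//.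
  rewrite mulr_suml; apply: ler_sum => f _; rewrite add0r.
  case: (lerP (\sum_i y (f i)) 0) => [yf|_] /=; last by rewrite mul0r sqr_ge0.
  rewrite mul1r -ler_sqrt ?sqr_ge0// !sqrtr_sqr.
  rewrite (gtr0_norm (mulr_gt0 nR0 m0)) /v sumrB sumr_const card_ord.
  rewrite -mulr_natl ler_normr; apply/orP; right; lra.
rewrite iter_emp_step_sqr// add0r -/(v _).
have nK (u : 'I_n -> R) : n%:R * emp_mean u = \sum_j u j.
  by rewrite /emp_mean mulVKf// gt_eqF.
rewrite mulrBr !nK lerD2l lerBlDr lerDl.
by rewrite mulr_ge0// sqr_ge0.
Qed.

Lemma measurable_sample d d' (W : measurableType d) (E : measurableType d')
    (R : realType) (P : probability W R) (n : nat) (Z : 'I_n -> {RV P >-> E}) :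
  measurable_fun setT (sample Z).
Proof.
apply/measurable_fun_tnthP => i.
rewrite (_ : _ \o _ = Z i)//.
by apply/funext => w /=; rewrite tnth_mktuple.
Qed.

Lemma percentile_intervalE (R : realType) (mu : {measure set R -> \bar R})
    (alpha t : R) : mu setT = 1%E -> 0 < alpha < 1 ->
  percentile_interval mu alpha t <->
  ((alpha / 2)%:E <= mu `]-oo, t]%classic)%E /\
  forall k : nat, (mu `]-oo, (t - k.+1%:R^-1)%R]%classic < (1 - alpha / 2)%:E)%E.
Proof.
move=> mu1 /andP[a0 a1].
have lo : 0 < alpha / 2 < 1 by lra.
have hi : 0 < 1 - alpha / 2 < 1 by lra.
have [h1 h2] := le_quantile mu1 t hi.
rewrite /percentile_interval /= in_itv /= (quantile_le mu1 t lo).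
by split=> [/andP[-> /h1]|[-> /h2]].
Qed.

Lemma measurable_percentile_interval d d' (W : measurableType d)
    (E : measurableType d') (R : realType) (S : W -> E) (k : R.-pker E ~> R)
    (alpha t : R) : measurable_fun setT S -> 0 < alpha < 1 ->
  measurable [set w | percentile_interval (k (S w)) alpha t].
Proof.
move=> mS a01; pose t' i := t - i.+1%:R^-1.
have mF A : measurable A -> measurable_fun setT (fun w => fine (k (S w) A)).
  by move=> mA; exact: (measurableT_comp (measurable_fine_kernel k mA)).
have Ev w := percentile_intervalE t (prob_kernel (S w) : k (S w) setT = 1%E) a01.
have -> : [set w | percentile_interval (k (S w)) alpha t] =
    [set w | alpha / 2 <= fine (k (S w) `]-oo, t]%classic)] `&`
    \bigcap_i [set w | fine (k (S w) `]-oo, t' i]%classic) < 1 - alpha / 2].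
  apply/seteqP; split => w.
    move=> /= /Ev[E1 E2]; split; first by rewrite /= -lee_fin prob_kernel_fineK.
    by move=> i _ /=; rewrite -lte_fin prob_kernel_fineK//; exact: E2.
  move=> [/= E1 E2]; apply/Ev; split.
    by rewrite -(prob_kernel_fineK k)// lee_fin.
  by move=> i; have := E2 i I; rewrite /= -lte_fin prob_kernel_fineK.
apply: measurableI.
  by rewrite -[X in measurable X]setTI; apply: measurable_fun_le => //; exact: mF.
by apply: bigcap_measurableType => // i _; apply: measurable_fun_lt_cst; exact: mF.
Qed.

Section single_sample_size.
Context d (W : measurableType d) (R : realType) (P : probability W R).
Context (mu : probability (R * R)%type R) (n : nat).
Variables (Z : 'I_n.+1 -> {RV P >-> (R * R)%type}) (J : 'I_n.+1 -> W -> 'I_n.+1).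
Variables (ratio : {RV P >-> R}) (k : R.-pker (n.+1.-tuple (R * R)%type) ~> R).
Variables (theta c m sigma2 C : R).
Hypothesis Z_iid : iid mu Z.
Hypothesis JS : uniform_draws P (sample Z) J.
Hypothesis ratioE : forall w, emp_mean (fun i => (Z (J i w) w).2) != 0 ->
  ratio w = emp_mean (fun i => (Z (J i w) w).1) / emp_mean (fun i => (Z (J i w) w).2).
Hypothesis kT : conditional_distribution (sample Z) ratio k.
Hypotheses (c0 : 0 < c) (m0 : 0 < m).

Let phi (z : R * R) := c * (z.1 - theta * z.2).

Hypothesis phi1 : has_mean mu phi 0.
Hypothesis phi2 : has_mean mu (fun z => phi z ^+ 2) 1.
Hypothesis phi4 : has_mean mu (fun z => phi z ^+ 4) C.
Hypothesis Y1 : has_mean mu (fun z => z.2 - m) 0.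
Hypothesis Y2 : has_mean mu (fun z => (z.2 - m) ^+ 2) sigma2.

Let s : R := (Num.sqrt n.+1%:R)^-1.
Let s0 : 0 < s. Proof. by rewrite invr_gt0 sqrtr_gt0 ltr0n. Qed.
Let s2 : s ^+ 2 = n.+1%:R^-1. Proof. exact: inv_sqrt_sqr. Qed.

Let Le (f : {ffun 'I_n.+1 -> 'I_n.+1}) : pred (n.+1.-tuple (R * R)%type) := fun x => \sum_(i < n.+1) phi (tnth x (f i)) <= 0.
Let Lt (f : {ffun 'I_n.+1 -> 'I_n.+1}) : pred (n.+1.-tuple (R * R)%type) := fun x => \sum_(i < n.+1) phi (tnth x (f i)) < 0.
Let Lbad (f : {ffun 'I_n.+1 -> 'I_n.+1}) : pred (n.+1.-tuple (R * R)%type) := fun x => \sum_(i < n.+1) (tnth x (f i)).2 <= 0.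

Let mphi : measurable_fun setT phi. Proof. exact: has_mean_measurable phi1. Qed.

Let mtnth j : measurable_fun setT (fun x : n.+1.-tuple (R * R)%type => tnth x j).
Proof. exact: measurable_tnth. Qed.

Let mLe (f : {ffun 'I_n.+1 -> 'I_n.+1}) : measurable [set x | Le f x].
Proof.
apply: measurable_fun_le_cst; apply: measurable_sum => i.
exact: (measurableT_comp mphi).
Qed.

Let mLt (f : {ffun 'I_n.+1 -> 'I_n.+1}) : measurable [set x | Lt f x].
Proof.
apply: measurable_fun_lt_cst; apply: measurable_sum => i.
exact: (measurableT_comp mphi).
Qed.

Let mLbad (f : {ffun 'I_n.+1 -> 'I_n.+1}) : measurable [set x | Lbad f x].
Proof.
apply: measurable_fun_le_cst; apply: measurable_sum => i.
exact: (measurableT_comp measurable_snd).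
Qed.

Let tnthZ w j : tnth (sample Z w) j = Z j w.
Proof. by rewrite tnth_mktuple. Qed.

Let H (L : {ffun 'I_n.+1 -> 'I_n.+1} -> pred (n.+1.-tuple (R * R)%type)) w : R :=
  draw_freq R L (sample Z w).

Let mean_sum_const (f : R * R -> R) v : has_mean mu f v ->
  has_mean P (fun w => \sum_j f (Z j w)) (n.+1%:R * v).
Proof.
move=> fv; have := has_mean_sum (fun j : 'I_n.+1 => iid_has_mean Z_iid j fv).
by rewrite sumr_const card_ord mulr_natl.
Qed.

(** Averaged over the sample, the squared sum and the sum of squares in the bound for the draws both
    have mean [n.+1%:R * sigma2], whence the factor 2. *)
Let Hbad_mean : exists2 p, has_mean P (H Lbad) p & p <= 2 * (sigma2 / (n.+1%:R * m ^+ 2)).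
Proof.
have mH : measurable_fun setT (H Lbad).
  apply: (measurableT_comp (@measurable_draw_freq _ _ R _ _ mLbad)).
  exact: measurable_sample.
pose q w := ((n.+1%:R * m) ^+ 2)^-1 *
  ((\sum_j ((Z j w).2 - m)) ^+ 2 + \sum_j ((Z j w).2 - m) ^+ 2).
have hq := has_meanZ ((n.+1%:R * m) ^+ 2)^-1
  (has_meanD (iid_sum_sqr Z_iid Y1 Y2) (mean_sum_const Y2)).
have Hq w : H Lbad w <= q w.
  rewrite /H /draw_freq /q mulrC [leRHS]mulrC [leLHS]mulrC.
  have := draw_freq_nonpos_le (fun j => (Z j w).2) (ltn0Sn n) m0.
  congr (_ * _ <= _); apply: eq_bigr => f _; rewrite /Lbad.
  by under [in RHS]eq_bigr do rewrite tnthZ.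
have H0 w : 0 <= H Lbad w.
  by rewrite mulr_ge0 ?invr_ge0 ?exprn_ge0// sumr_ge0.
have [p Hp] := has_mean_dominated mH hq (fun w => le_trans
  (eq_ind_r (fun x => x <= _) (lexx _) (ger0_norm (H0 w))) (Hq w)).
exists p => //; apply: le_trans (has_mean_le Hp hq Hq) _.
rewrite le_eqVlt; apply/orP; left; apply/eqP; field.
by rewrite gt_eqF// gt_eqF// ltr_pwDl.
Qed.

Let drawE w (f : {ffun 'I_n.+1 -> 'I_n.+1}) : (forall i, f i = J i w) ->
  (Le f (sample Z w) = (\sum_i phi (Z (J i w) w) <= 0)) *
  (Lt f (sample Z w) = (\sum_i phi (Z (J i w) w) < 0)) *
  (Lbad f (sample Z w) = (\sum_i (Z (J i w) w).2 <= 0)).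
Proof.
move=> fJ; rewrite /Le /Lt /Lbad.
have e (g : R * R -> R) : \sum_(i < n.+1) g (tnth (sample Z w) (f i)) =
    \sum_(i < n.+1) g (Z (J i w) w).
  by apply: eq_bigr => i _; rewrite tnthZ fJ.
by rewrite !e.
Qed.

Let ratio_cmp w : 0 < \sum_i (Z (J i w) w).2 ->
  (ratio w <= theta) = (\sum_i phi (Z (J i w) w) <= 0) /\
  (ratio w < theta) = (\sum_i phi (Z (J i w) w) < 0).
Proof.
move=> Y0; have nR0 : 0 < n.+1%:R^-1 :> R by rewrite invr_gt0.
rewrite ratioE; last by rewrite gt_eqF// mulr_gt0.
rewrite /emp_mean -mulf_div divff ?gt_eqF// mul1r.
rewrite ler_pdivrMr// ltr_pdivrMr// /phi -mulr_sumr sumrB -mulr_sumr.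
by rewrite pmulr_rle0// pmulr_rlt0// subr_le0 subr_lt0.
Qed.

Let D w j := phi (Z j w).

(** The random part of [boot_clt_err], with [|x|] replaced by its upper bound [s + s^-1 * x ^ 2],
    because squares have an explicit mean. Here [x] has variance of order [s ^ 2], so the weight [s]
    balances the two terms. *)
Let err h w : R :=
  (s + s^-1 * (emp_mean (fun j => D w j ^+ 2) - 1) ^+ 2 + emp_mean (D w) ^+ 2) / h ^+ 2 +
  2 * s * (2 + 17 * emp_mean (fun j => D w j ^+ 4)) / h ^+ 3.

Let boot_clt_err_le h w : boot_clt_err h (D w) <= 3 * h + s + err h w.
Proof.
rewrite /boot_clt_err /err -/s; set x := emp_mean _ - 1.
have key : `|x| <= s + s^-1 * x ^+ 2.
  rewrite -(ler_pM2l s0) mulrDr mulrA mulfV ?gt_eqF// mul1r -(real_normK (num_real x)).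
  have := sqr_ge0 (`|x| - s); have := sqr_ge0 `|x|; have := sqr_ge0 s; nra.
have h2 : 0 <= (h ^+ 2)^-1 by rewrite invr_ge0 exprn_even_ge0.
by have := ler_wpM2r h2 key; lra.
Qed.

Let err_mean h : 0 < h -> has_mean P (err h)
  ((s * C + s ^+ 2) / h ^+ 2 + 2 * s * (2 + 17 * C) / h ^+ 3).
Proof.
move=> h0.
have hD1 : has_mean P (fun w => emp_mean (D w) ^+ 2) (s ^+ 2).
  have := has_meanZ (n.+1%:R ^- 2) (iid_sum_sqr Z_iid phi1 phi2).
  rewrite mulr1 (_ : _ * _ = s ^+ 2); last by rewrite s2; field.
  by congr has_mean; apply/funext => w; rewrite /emp_mean exprMn exprVn.
have hD2 : has_mean P (fun w => (emp_mean (fun j => D w j ^+ 2) - 1) ^+ 2)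
    (s ^+ 2 * (C - 1)).
  have g1 : has_mean mu (fun z => phi z ^+ 2 - 1) 0.
    by rewrite -(subrr 1); exact: has_meanD phi2 (has_mean_cst _ _).
  have g2 : has_mean mu (fun z => (phi z ^+ 2 - 1) ^+ 2) (C - 1).
    have := has_meanD phi4 (has_meanD (has_meanZ (-2) phi2) (has_mean_cst mu 1)).
    rewrite (_ : C + _ = C - 1); last by ring.
    by congr has_mean; apply/funext => z; ring.
  have := has_meanZ (n.+1%:R ^- 2) (iid_sum_sqr Z_iid g1 g2).
  rewrite (_ : _ * _ = s ^+ 2 * (C - 1)); last by rewrite s2; field.
  congr has_mean; apply/funext => w; rewrite /emp_mean -exprVn -exprMn; congr (_ ^+ 2).
  by rewrite sumrB sumr_const card_ord mulrBr mulVf.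
have hD4 : has_mean P (fun w => emp_mean (fun j => D w j ^+ 4)) C.
  have := has_meanZ (n.+1%:R^-1) (mean_sum_const phi4).
  by rewrite mulKf.
have := has_meanD
  (has_meanZ (h ^- 2) (has_meanD (has_meanD (has_mean_cst P s) (has_meanZ s^-1 hD2)) hD1))
  (has_meanZ (2 * s / h ^+ 3) (has_meanD (has_mean_cst P 2) (has_meanZ 17 hD4))).
congr has_mean; first by apply/funext => w; rewrite /err; ring.
by field; rewrite !gt_eqF.
Qed.

Let markov_err (h eps : R) : 0 < h -> 0 < eps -> measurable [set w | eps <= err h w] /\ fine (P [set w | eps <= err h w]) <=
  ((s * C + s ^+ 2) / h ^+ 2 + 2 * s * (2 + 17 * C) / h ^+ 3) / eps.
Proof.
move=> h0 eps0; have hm := err_mean h0.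
have me : measurable [set w | eps <= err h w].
  rewrite (_ : [set w | _] = [set w | -1 * err h w <= - eps]).
    exact: measurable_fun_le_cst (has_mean_measurable (has_meanZ (-1) hm)).
  by apply/funext => w /=; rewrite mulN1r lerN2.
split=> //; rewrite ler_pdivlMr// mulrC.
apply: (has_mean_le (has_meanZ eps (has_mean_prob P me)) hm) => w.
case: (boolP (eps <= err h w)) => [|_]; first by rewrite mulr1.
rewrite mulr0 /err addr_ge0// divr_ge0 ?exprn_ge0 ?(ltW h0)//.
  by rewrite !addr_ge0 ?sqr_ge0 ?(ltW s0)// mulr_ge0 ?sqr_ge0 ?invr_ge0 ?(ltW s0).
rewrite mulr_ge0 ?(ltW s0)//; first by rewrite mulr_ge0// (ltW s0).
rewrite addr_ge0// mulr_ge0//.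
rewrite mulr_ge0 ?invr_ge0// sumr_ge0// => j _; exact: exprn_even_ge0.
Qed.

(** In [eta0], [3 * h + s] comes from smoothing, one [eps] from the kernel against the draw
    frequency and one from [err]. [eta] is the error for the sum of the contrasts, whose third
    absolute moment is at most [1 + C]. [beta] bounds the exceptional event: Markov's inequality for
    [err], and the kernel comparison used twice, at [theta] and at its left limit. *)
Lemma percentile_interval_coverage alpha h eps :
  0 < alpha < 1 -> 0 < h -> 0 < eps ->
  let eta0 := 3 * h + s + 2 * eps in
  let eta := 3 * h + s + 2 * s * (2 + C) / h ^+ 3 in
  let e := (s * C + s ^+ 2) / h ^+ 2 + 2 * s * (2 + 17 * C) / h ^+ 3 in
  let beta := (e + 4 * (sigma2 / (n.+1%:R * m ^+ 2))) / eps in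
  eta0 + 2 * (h + s) < alpha / 2 ->
  `|fine (P [set w | percentile_interval (k (sample Z w)) alpha theta]) - (1 - alpha)| <=
  2 * eta0 + 5 * (h + s) + 2 * eta + beta.
Proof.
move=> a01 h0 eps0 eta0 eta e beta small.
have mS := measurable_sample Z.
have k1 x : k x setT = 1%E := prob_kernel x.
pose A1 : set R := `]-oo, theta]%classic; pose A2 : set R := `]-oo, theta[%classic.
have mA1 : measurable A1 := measurable_itv _.
have mA2 : measurable A2 := measurable_itv _.
pose T w := s * \sum_j phi (Z j w).
have mT : measurable_fun setT T.
  apply: measurable_funM => //; apply: measurable_sum => j.
  exact: (measurableT_comp mphi).
have [p Hp p_le] := Hbad_mean.
have Jf w i : [ffun i => J i w] i = J i w by rewrite ffunE.
have sumY w : ~~ Lbad [ffun i => J i w] (sample Z w) -> 0 < \sum_i (Z (J i w) w).2.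
  by rewrite (drawE (Jf w)).2 ltNge.
have inA1 x : (x \in A1) = (x <= theta).
  by apply/idP/idP => [/set_mem|xt]; last apply/mem_set; rewrite /A1/= in_itv.
have inA2 x : (x \in A2) = (x < theta).
  by apply/idP/idP => [/set_mem|xt]; last apply/mem_set; rewrite /A2/= in_itv.
pose F1 w := fine (k (sample Z w) A1); pose F2 w := fine (k (sample Z w) A2).
have [B1 _] : fine (P [set w | H Le w + eps <= F1 w]) <= p / eps /\
    fine (P [set w | F1 w + eps <= H Le w]) <= p / eps.
  apply: (kernel_draw_freq_close mS kT JS mLe mLbad mA1 _ Hp eps0) => w /sumY Yw.
  by rewrite inA1 (ratio_cmp Yw).1 (drawE (Jf w)).1.1.
have [_ B2] : fine (P [set w | H Lt w + eps <= F2 w]) <= p / eps /\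
    fine (P [set w | F2 w + eps <= H Lt w]) <= p / eps.
  apply: (kernel_draw_freq_close mS kT JS mLt mLbad mA2 _ Hp eps0) => w /sumY Yw.
  by rewrite inA2 (ratio_cmp Yw).2 (drawE (Jf w)).1.2.
have [mB3 B3] := markov_err h0 eps0.
have mF A : measurable A -> measurable_fun setT (fun w => fine (k (sample Z w) A)).
  by move=> mA; exact: (measurableT_comp (measurable_fine_kernel k mA)).
have mH (L : {ffun 'I_n.+1 -> 'I_n.+1} -> pred (n.+1.-tuple (R * R)%type)) :
    (forall f, measurable [set x | L f x]) -> measurable_fun setT (H L).
  by move=> mL; exact: (measurableT_comp (@measurable_draw_freq _ _ R _ _ mL)).
have mle (f g : W -> R) : measurable_fun setT f -> measurable_fun setT g ->
    measurable [set w | f w + eps <= g w].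
  move=> mf mg; rewrite -[X in measurable X]setTI; apply: measurable_fun_le => //.
  exact: measurable_funD.
have mB1 : measurable [set w | H Le w + eps <= F1 w].
  by apply: mle; [exact: mH|exact: mF].
have mB2 : measurable [set w | F2 w + eps <= H Lt w].
  by apply: mle; [exact: mF|exact: mH].
pose bad := [set w | H Le w + eps <= F1 w] `|` [set w | F2 w + eps <= H Lt w] `|`
  [set w | eps <= err h w].
have mB12 := measurableU _ _ mB1 mB2.
have mbad : measurable bad by exact: measurableU.
have Pbad : fine (P bad) <= beta.
  have := fine_probD_le P mbad mB12 mB3 (@subset_refl _ _).
  have := fine_probD_le P mB12 mB1 mB2 (@subset_refl _ _).
  have pe : p / eps <= 2 * (sigma2 / (n.+1%:R * m ^+ 2)) / eps.
    by rewrite ler_pM2r// invr_gt0.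
  have {}B3 : fine (P [set w | eps <= err h w]) <= e / eps := B3.
  rewrite /bad /beta; set r := sigma2 / _ in pe *; lra.
have F21 w : F2 w <= F1 w.
  rewrite /F1 /F2 -lee_fin !prob_kernel_fineK//; apply: le_measure; rewrite ?inE//.
  by apply: subset_itvl; rewrite bnd_simp.
(* [F1] is bounded above and [F2] below; the two remaining bounds follow from [F2 <= F1]. *)
have good w : ~ bad w -> F1 w <= sign_cdf n.+1 (- T w) + eta0 /\
    sign_cdf n.+1 (- T w) - eta0 <= F2 w.
  move=> /not_orP[/not_orP[/negP + /negP +] /negP]; rewrite -!ltNge => G1 G2 G3.
  have := boot_clt_err_le h w.
  have : H Le w <= sign_cdf n.+1 (- T w) + boot_clt_err h (D w).
    have := boot_clt_le (ltn0Sn n) (D w) h0; congr (_ * _ <= _).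
    by apply: eq_bigr => f _; rewrite /Le; under [in RHS]eq_bigr do rewrite tnthZ.
  have : sign_cdf n.+1 (- T w) - boot_clt_err h (D w) <= H Lt w.
    have := boot_clt_ge (ltn0Sn n) (D w) h0; congr (_ <= _ * _).
    by apply: eq_bigr => f _; rewrite /Lt; under [in RHS]eq_bigr do rewrite tnthZ.
  by rewrite /eta0 => *; split; lra.
have EvE w := percentile_intervalE theta (k1 (sample Z w)) a01.
have F1E w : (F1 w)%:E = k (sample Z w) A1 by exact: prob_kernel_fineK.
have F2E w : (F2 w)%:E = k (sample Z w) A2 by exact: prob_kernel_fineK.
set Ev := [set w | _].
have mEv : measurable Ev by exact: measurable_percentile_interval.
have Evup w : Ev w -> alpha / 2 <= F1 w /\ F2 w <= 1 - alpha / 2.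
  move=> /EvE[E1 E2]; split; first by rewrite -lee_fin F1E.
  by rewrite -lee_fin F2E; apply: mu_rays_left => // i; exact/ltW/E2.
have Evdown w : alpha / 2 <= F1 w -> F2 w < 1 - alpha / 2 -> Ev w.
  move=> E1 E2; apply/EvE; split; first by rewrite -/A1 -F1E lee_fin.
  move=> i; apply: (@le_lt_trans _ _ (F2 w)%:E); last by rewrite lte_fin.
  rewrite F2E; apply: le_measure; rewrite ?inE//.
  by apply: subset_itvl; rewrite bnd_simp ltrBlDr ltrDl.
have [rho rho3 rhoC] : exists2 rho, has_mean mu (fun z => `|phi z| ^+ 3) rho & rho <= 1 + C.
  have cub z : `|phi z| ^+ 3 <= phi z ^+ 2 + phi z ^+ 4.
    rewrite -(real_normK (num_real (phi z))) (exprM _ 2 2).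
    rewrite -(real_normK (num_real (phi z))) -exprM.
    have := normr_ge0 (phi z); set y := `|phi z| => y0.
    have : 0 <= y * y * (1 - y + y ^+ 2) by rewrite !mulr_ge0//; nra.
    by rewrite !exprS expr0; nra.
  have h24 := has_meanD phi2 phi4.
  have [||rho hrho] := has_mean_dominated (f := fun z => `|phi z| ^+ 3) _ h24 _.
  - by apply: measurable_funX; exact: measurableT_comp.
  - by move=> z; rewrite ger0_norm ?exprn_ge0.
  - by exists rho => //; exact: has_mean_le hrho h24 cub.
have clt := iid_clt Z_iid phi1 phi2 rho3 h0.
have etaE : 3 * h + s + 2 * s * (1 + rho) / h ^+ 3 <= eta.
  rewrite /eta lerD2l ler_wpM2r ?invr_ge0 ?exprn_ge0 ?(ltW h0)//.
  by rewrite ler_wpM2l ?mulr_ge0 ?(ltW s0)//; lra.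
have e00 : 0 <= eta0 by rewrite /eta0; have := s0; lra.
have /andP[a0 a1] := a01.
rewrite (_ : 1 - alpha = 1 - alpha / 2 - alpha / 2); last by field.
apply: (@coverage_bounds _ _ _ P n.+1 T _ _ eta0 h eta beta Ev bad) => //.
- by move=> t; have [+ _] := clt t; rewrite -/s => /le_trans; apply; rewrite lerD2l.
- by move=> t; have [_] := clt t; rewrite -/s; apply: le_trans; rewrite lerD2l lerN2.
- by move=> w /Evup[E1 E2] /good[G1 G2]; apply/andP; split; lra.
- move=> w /good[G1 G2] U1 U2; have := F21 w => F12.
  by apply: Evdown; lra.
- by rewrite -/s; lra.
- by rewrite -/s; lra.
Qed.

End single_sample_size.

(** * Asymptotics *)

(** The form is evaluated at [(1, - t)], the direction of a contrast. Determinant over trace is at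
    most the smallest eigenvalue, yet rational in the entries. *)
Lemma sym_posdef2_lower (R : realType) (V : 'M[R]_2) : sym_posdef V ->
  [/\ 0 < V 1 1, V 1 0 = V 0 1 & exists2 l, 0 < l &
    forall t, l * (1 + t ^+ 2) <= V 0 0 - 2 * t * V 0 1 + t ^+ 2 * V 1 1].
Proof.
move=> [VT Vpos]; have V10 : V 1 0 = V 0 1 by rewrite -{1}VT mxE.
have quad (a b : R) : (a != 0) || (b != 0) ->
    0 < a ^+ 2 * V 0 0 + 2 * a * b * V 0 1 + b ^+ 2 * V 1 1.
  move=> ab; pose v : 'cV[R]_2 := \col_i (if i == 0 then a else b).
  have := Vpos v; rewrite !mxE !big_ord_recl !big_ord0 /= !mxE.
  rewrite !big_ord_recl !big_ord0 /= !mxE /=.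
  rewrite (_ : lift ord0 ord0 = 1); last exact/val_inj.
  have -> : @ord0 1 = 0 by exact/val_inj.
  rewrite V10 => H; apply: lt_le_trans (H _) _; last first.
    by rewrite le_eqVlt; apply/orP; left; apply/eqP; rewrite /=; ring.
  apply: contraTN ab => /eqP v0.
  have := congr1 (fun M : 'cV[R]_2 => M 0 0) v0; rewrite !mxE/= => ->.
  by have := congr1 (fun M : 'cV[R]_2 => M 1 0) v0; rewrite !mxE/= => ->; rewrite eqxx.
have p0 : 0 < V 0 0.
  by have := quad 1 0; rewrite oner_eq0 => /(_ isT); rewrite expr0n/=; lra.
have r0 : 0 < V 1 1.
  by have := quad 0 1; rewrite oner_eq0 orbT => /(_ isT); rewrite expr0n/=; lra.
split=> //; set p := V 0 0 in quad p0 *; set r := V 1 1 in quad r0 *; set q := V 0 1 in quad *.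
have det0 : 0 < p * r - q ^+ 2.
  have := quad r (- q); rewrite gt_eqF// => /(_ isT).
  have -> : r ^+ 2 * p + 2 * r * (- q) * q + (- q) ^+ 2 * r = r * (p * r - q ^+ 2) by ring.
  by rewrite pmulr_rgt0.
have pr0 : 0 < p + r by rewrite addr_gt0.
exists ((p * r - q ^+ 2) / (p + r)); first by rewrite divr_gt0.
move=> t; rewrite -subr_ge0.
(* The left-hand side is the form of [V - l I], whose determinant is [l ^+ 2]
   when [l] is the ratio of the determinant of [V] to its trace. *)
have -> : p - 2 * t * q + t ^+ 2 * r - (p * r - q ^+ 2) / (p + r) * (1 + t ^+ 2) =
  ((p - t * q) ^+ 2 + (q - t * r) ^+ 2) / (p + r) by field; rewrite gt_eqF.
by rewrite divr_ge0 ?addr_ge0 ?sqr_ge0// ltW.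
Qed.

Lemma quartic_le_powR (R : realType) (a delta : R) : 0 < delta ->
  a ^+ 4 <= 1 + `|a| `^ (4 + delta).
Proof.
move=> d0; rewrite -(ger0_norm (exprn_even_ge0 a (erefl : ~~ odd 4))) normrX.
have [a1|a1] := lerP `|a| 1.
  by apply: (@le_trans _ _ 1); [exact: exprn_ile1|rewrite lerDl powR_ge0].
rewrite -[leLHS]add0r lerD// -powR_mulrn// ler_powR ?(ltW a1)//; lra.
Qed.

(** * Moments of a contrast *)

Section bivariate_moments.
Context (R : realType) (mu : probability (R * R)%type R).
Variables (gX gY K : R).
Hypotheses (gX0 : 0 < gX) (gY0 : 0 < gY).
Let q (z : R * R) := (gX * z.1) ^+ 4 + (gY * z.2) ^+ 4.
Hypothesis q_mean : has_mean mu q K.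

Lemma quartic_moments : exists EX EY vxx vxy vyy,
  [/\ has_mean mu (fun z => z.1) EX, has_mean mu (fun z => z.2) EY,
      has_mean mu (fun z => (gX * z.1 - gX * EX) ^+ 2) vxx,
      has_mean mu (fun z => (gX * z.1 - gX * EX) * (gY * z.2 - gY * EY)) vxy &
      has_mean mu (fun z => (gY * z.2 - gY * EY) ^+ 2) vyy].
Proof.
have q1 := has_meanD (has_mean_cst mu 1) q_mean.
have le4 (x : R) : 0 <= x ^+ 4 by rewrite exprn_even_ge0.
have sq (x : R) : x ^+ 2 <= (1 + x ^+ 4) / 2.
  have := sqr_ge0 (x ^+ 2 - 1); rewrite (exprM _ 2 2); nra.
have ab (x : R) : `|x| <= 1 + x ^+ 4.
  have := sq x; rewrite -(real_normK (num_real x)) => H1.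
  have := sqr_ge0 (`|x| - 1); have := le4 x; nra.
have m1 : measurable_fun setT (fun z : R * R => gX * z.1).
  by apply: measurable_funM => //; exact: measurable_fst.
have m2 : measurable_fun setT (fun z : R * R => gY * z.2).
  by apply: measurable_funM => //; exact: measurable_snd.
have [|x hx] := has_mean_dominated m1 q1.
  by move=> z; rewrite (le_trans (ab _))// lerD2l /q lerDl.
have [|y hy] := has_mean_dominated m2 q1.
  by move=> z; rewrite (le_trans (ab _))// lerD2l /q lerDr.
have [|xx hxx] := has_mean_dominated (f := fun z => (gX * z.1) ^+ 2)
    (measurable_funX _ m1) q1.
  move=> z; rewrite ger0_norm ?sqr_ge0// (le_trans (sq _))// /q.
  by have := le4 (gX * z.1); have := le4 (gY * z.2); lra.
have [|yy hyy] := has_mean_dominated (f := fun z => (gY * z.2) ^+ 2)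
    (measurable_funX _ m2) q1.
  move=> z; rewrite ger0_norm ?sqr_ge0// (le_trans (sq _))// /q.
  by have := le4 (gX * z.1); have := le4 (gY * z.2); lra.
have [|xy hxy] := has_mean_dominated (f := fun z => (gX * z.1) * (gY * z.2))
    (measurable_funM m1 m2) q1.
  move=> z; rewrite /q; have := sq (gX * z.1); have := sq (gY * z.2).
  set a := gX * z.1; set b := gY * z.2.
  have := sqr_ge0 (a - b); have := sqr_ge0 (a + b); have := le4 a; have := le4 b.
  by rewrite ler_norml => *; apply/andP; split; nra.
exists (gX^-1 * x), (gY^-1 * y), (xx + (- x ^+ 2)), (xy - x * y), (yy - y ^+ 2).
have gXx : gX * (gX^-1 * x) = x by rewrite mulVKf ?gt_eqF.
have gYy : gY * (gY^-1 * y) = y by rewrite mulVKf ?gt_eqF.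
split; rewrite ?gXx ?gYy.
- have := has_meanZ gX^-1 hx; congr has_mean; apply/funext => z.
  by rewrite mulKf ?gt_eqF.
- have := has_meanZ gY^-1 hy; congr has_mean; apply/funext => z.
  by rewrite mulKf ?gt_eqF.
- have := has_meanD hxx (has_meanD (has_meanZ (-2 * x) hx) (has_mean_cst mu (x ^+ 2))).
  by congr has_mean; [apply/funext => z; ring|ring].
- have := has_meanD hxy (has_meanD (has_meanZ (- y) hx)
    (has_meanD (has_meanZ (- x) hy) (has_mean_cst mu (x * y)))).
  by congr has_mean; [apply/funext => z; ring|ring].
- have := has_meanD hyy (has_meanD (has_meanZ (-2 * y) hy) (has_mean_cst mu (y ^+ 2))).
  by congr has_mean; [apply/funext => z; ring|ring].
Qed.

(** In normalized units the contrast is [a - t * b]. Its square is at most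
    [(1 + t ^ 2) * (a ^ 2 + b ^ 2)] by Cauchy-Schwarz and its variance at least [l * (1 + t ^ 2)],
    so [t] cancels and the bound is uniform in the size of [EX / EY]. As the means cancel in the
    contrast, uncentered fourth moments of the coordinates suffice. *)
Lemma standardized_contrast EX EY vxx vxy vyy l :
  0 < EY -> has_mean mu (fun z => z.1) EX -> has_mean mu (fun z => z.2) EY ->
  has_mean mu (fun z => (gX * z.1 - gX * EX) ^+ 2) vxx ->
  has_mean mu (fun z => (gX * z.1 - gX * EX) * (gY * z.2 - gY * EY)) vxy ->
  has_mean mu (fun z => (gY * z.2 - gY * EY) ^+ 2) vyy ->
  0 < l -> (forall t, l * (1 + t ^+ 2) <= vxx - 2 * t * vxy + t ^+ 2 * vyy) ->
  exists c C, [/\ 0 < c, C <= 8 * K / l ^+ 2,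
    has_mean mu (fun z => c * (z.1 - EX / EY * z.2)) 0,
    has_mean mu (fun z => (c * (z.1 - EX / EY * z.2)) ^+ 2) 1 &
    has_mean mu (fun z => (c * (z.1 - EX / EY * z.2)) ^+ 4) C].
Proof.
move=> EY0 hx hy hxx hxy hyy l0 l_le.
set theta := EX / EY; pose t := gX * theta / gY.
have tE : t * gY = gX * theta by rewrite /t divfK ?gt_eqF.
have EXE : EX = theta * EY by rewrite /theta divfK ?gt_eqF.
pose S2 := vxx - 2 * t * vxy + t ^+ 2 * vyy.
have S2l : l * (1 + t ^+ 2) <= S2 by exact: l_le.
have t1 : 0 < 1 + t ^+ 2 by rewrite ltr_pwDl// sqr_ge0.
have S20 : 0 < S2 by rewrite (lt_le_trans _ S2l)// mulr_gt0.
pose c := gX / Num.sqrt S2.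
have c0 : 0 < c by rewrite divr_gt0 ?sqrtr_gt0.
have c2 : c ^+ 2 = gX ^+ 2 / S2 by rewrite /c expr_div_n sqr_sqrtr// ltW.
have h1 : has_mean mu (fun z => c * (z.1 - theta * z.2)) 0.
  have := has_meanZ c (has_meanD hx (has_meanZ (- theta) hy)).
  rewrite mulNr -EXE subrr mulr0; congr has_mean.
  by apply/funext => z; rewrite mulNr.
have h2 : has_mean mu (fun z => (c * (z.1 - theta * z.2)) ^+ 2) 1.
  have := has_meanZ S2^-1 (has_meanD hxx (has_meanD (has_meanZ (- 2 * t) hxy)
    (has_meanZ (t ^+ 2) hyy))).
  have -> : S2^-1 * (vxx + (- 2 * t * vxy + t ^+ 2 * vyy)) = 1.
    rewrite (_ : vxx + _ = S2) ?mulVf ?gt_eqF//.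
    by rewrite /S2; ring.
  congr has_mean; apply/funext => z.
  rewrite [RHS]exprMn c2.
  have -> : (gX * z.1 - gX * EX) ^+ 2 + (- 2 * t * ((gX * z.1 - gX * EX) * (gY * z.2 - gY * EY))
     + t ^+ 2 * (gY * z.2 - gY * EY) ^+ 2) =
     ((gX * z.1 - gX * EX) - (t * gY) * (z.2 - EY)) ^+ 2 by ring.
  rewrite tE {1}EXE.
  have -> : gX * z.1 - gX * (theta * EY) - gX * theta * (z.2 - EY) =
    gX * (z.1 - theta * z.2) by ring.
  by rewrite exprMn; ring.
have quartic z : (c * (z.1 - theta * z.2)) ^+ 4 <= 8 / l ^+ 2 * q z.
  have -> : (c * (z.1 - theta * z.2)) ^+ 4 =
      ((gX * z.1 - (t * gY) * z.2) ^+ 2 / S2) ^+ 2.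
    rewrite (exprM _ 2 2) (exprMn 2 c) c2 tE.
    congr (_ ^+ 2); rewrite (_ : gX * z.1 - _ = gX * (z.1 - theta * z.2)); last ring.
    by rewrite exprMn; ring.
  rewrite /q -(mulrA t); set a := gX * z.1; set b := gY * z.2.
  have H1 : (a - t * b) ^+ 2 / S2 <= (a ^+ 2 + b ^+ 2) / l.
    have H0 : (a - t * b) ^+ 2 <= (1 + t ^+ 2) * (a ^+ 2 + b ^+ 2).
      rewrite -subr_ge0 (_ : _ - _ = (t * a + b) ^+ 2) ?sqr_ge0//; ring.
    rewrite ler_pdivrMr// [leRHS]mulrAC ler_pdivlMr//.
    apply: le_trans (ler_wpM2r (ltW l0) H0) _.
    have ab0 : 0 <= a ^+ 2 + b ^+ 2 by rewrite addr_ge0 ?sqr_ge0.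
    by have := ler_wpM2l ab0 S2l; lra.
  apply: (@le_trans _ _ (((a ^+ 2 + b ^+ 2) / l) ^+ 2)).
    have A0 : 0 <= (a - t * b) ^+ 2 / S2 by rewrite divr_ge0 ?sqr_ge0 ?(ltW S20).
    by rewrite ler_sqr ?nnegrE// (le_trans A0).
  rewrite (expr_div_n _ l) [leRHS]mulrAC ler_wpM2r ?invr_ge0 ?sqr_ge0//.
  rewrite (exprM a 2 2) (exprM b 2 2).
  have := sqr_ge0 (a ^+ 2 - b ^+ 2); have := sqr_ge0 (a ^+ 2); have := sqr_ge0 (b ^+ 2); nra.
have m4 : measurable_fun setT (fun z : R * R => (c * (z.1 - theta * z.2)) ^+ 4).
  by apply: measurable_funX; exact: has_mean_measurable h1.
have hq := has_meanZ (8 / l ^+ 2) q_mean.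
have [|C hC] := has_mean_dominated m4 hq.
  by move=> z; rewrite ger0_norm// exprn_even_ge0.
exists c, C; split => //.
by apply: le_trans (has_mean_le hC hq quartic) _; rewrite mulrAC.
Qed.

End bivariate_moments.

Lemma has_mean_expectation d (W : measurableType d) (R : realType)
    (P : probability W R) (f : W -> R) m : has_mean P f m -> ('E_P[f] = m%:E)%E.
Proof. by rewrite unlock => -[]. Qed.

Lemma fine_covariance d (W : measurableType d) (R : realType)
    (P : probability W R) (f g : W -> R) mf mg v :
  has_mean P f mf -> has_mean P g mg ->
  has_mean P (fun w => (f w - mf) * (g w - mg)) v -> fine (covariance P f g) = v.
Proof.
move=> /has_mean_expectation Ef /has_mean_expectation Eg hv.
by rewrite covariance.unlock Ef Eg (has_mean_expectation hv).
Qed.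

Lemma inv_sqrt_eventually (R : realType) (c : R) : 0 < c ->
  \forall n \near \oo, (Num.sqrt n.+1%:R)^-1 <= c.
Proof.
move=> c0; near=> n.
rewrite invf_ple ?posrE ?sqrtr_gt0// -[leLHS]ger0_norm ?invr_ge0 ?(ltW c0)//.
rewrite -sqrtr_sqr ler_wsqrtr// (@le_trans _ _ n%:R) ?ler_nat//.
by near: n; exact: nbhs_infty_ger.
Unshelve. all: by end_near. Qed.

(* Row n of the triangular array has n.+1 observations, so that the sample size
   ranges over the positive integers. *)
Theorem theorem3p3 (R : realType)
  (d : nat -> measure_display) (W : forall n : nat, measurableType (d n))
  (P : forall n : nat, probability (W n) R)
  (PXY : nat -> probability (R * R)%type R)
  (Z : forall n : nat, 'I_n.+1 -> {RV (P n) >-> (R * R)%type})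
  (J : forall n : nat, 'I_n.+1 -> W n -> 'I_n.+1)
  (gX gY : nat -> R) (V : 'M[R]_2) (delta : R)
  (ratio : forall n : nat, {RV (P n) >-> R})
  (boot : forall n : nat, R.-pker (n.+1.-tuple (R * R)%type) ~> R) :
  let X n (i : 'I_n.+1) (w : W n) : R := (Z n i w).1 in
  let Y n (i : 'I_n.+1) (w : W n) : R := (Z n i w).2 in
  let X1 n (i : 'I_n.+1) (w : W n) : R := X n (J n i w) w in
  let Y1 n (i : 'I_n.+1) (w : W n) : R := Y n (J n i w) w in
  let EX n : R := fine 'E_(P n)[X n ord0] in
  let EY n : R := fine 'E_(P n)[Y n ord0] in
  let SNR n : R :=
    EY n / (Num.sqrt (V 1 1) * (Num.sqrt n.+1%:R)^-1 * (gY n)^-1) in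
  (forall n, iid (PXY n) (Z n)) ->
  (forall n, 0 < EY n) ->
  (forall n, 'E_(P n)[(fun w => X n ord0 w ^+ 2)%R] < +oo)%E ->
  (forall n, 'E_(P n)[(fun w => Y n ord0 w ^+ 2)%R] < +oo)%E ->
  (forall n, uniform_draws (P n) (sample (Z n)) (J n)) ->
  (* the ratio of the bootstrapped means, arbitrary where it is undefined *)
  (forall n w, emp_mean (Y1 n ^~ w) != 0 ->
     ratio n w = emp_mean (X1 n ^~ w) / emp_mean (Y1 n ^~ w)) ->
  (forall n, conditional_distribution (sample (Z n)) (ratio n) (boot n)) ->
  (* (i) *)
  (forall n, 0 < gX n) -> (forall n, 0 < gY n) -> sym_posdef V ->
  cov_matrix (P n) (fun (j : 'I_2) (w : W n) =>
      if j == 0 then gX n * X n ord0 w else gY n * Y n ord0 w)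
    @[n --> \oo] --> V ->
  (* (ii) *)
  0 < delta ->
  (ereal_sup (range (fun n => 'E_(P n)[(fun w =>
      `|gX n * X n ord0 w| `^ (4 + delta) +
      `|gY n * Y n ord0 w| `^ (4 + delta))%R])) < +oo)%E ->
  (* (iii) *)
  P n [set w | emp_mean (Y n ^~ w) = 0] @[n --> \oo] --> 0%E ->
  (* (iv) *)
  P n [set w | emp_mean (Y1 n ^~ w) = 0] @[n --> \oo] --> 0%E ->
  SNR n @[n --> \oo] --> +oo ->
  forall alpha : R, 0 < alpha < 1 ->
  P n [set w | percentile_interval (boot n (sample (Z n) w)) alpha (EX n / EY n)]
    @[n --> \oo] --> (1 - alpha)%:E.
Proof.
move=> X Y X1 Y1 EX EY SNR Z_iid EY0 _ _ JS ratioE kT gX0 gY0 Vpos covV delta0 mom _ _.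
move=> SNRoo alpha a01.
have [V11 V10 [l l0 l_le]] := sym_posdef2_lower Vpos.
have [K momK] : exists K : R, forall n, ('E_(P n)[(fun w =>
    `|gX n * X n ord0 w| `^ (4 + delta) +
    `|gY n * Y n ord0 w| `^ (4 + delta))%R] <= K%:E)%E.
  have ub n := ereal_sup_ubound (ex_intro2 _ _ n I erefl) (S := range (fun n =>
    'E_(P n)[(fun w => `|gX n * X n ord0 w| `^ (4 + delta) +
      `|gY n * Y n ord0 w| `^ (4 + delta))%R]%E)).
  move: mom ub; case: (ereal_sup _) => [K _ ub| |_ ub] //; first by exists K.
  by exists 0 => n; have := ub n; rewrite leeNy_eq => /eqP ->; rewrite leNye.
pose A n (i j : 'I_2) := cov_matrix (P n) (fun (j : 'I_2) (w : W n) =>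
  if j == 0 then gX n * X n ord0 w else gY n * Y n ord0 w) i j.
have Acvg i j : A n i j @[n --> \oo] --> V i j.
  have cij : {for V, continuous (fun M : 'M[R]_2 => M i j)}.
    exact: coord_continuous.
  exact: (continuous_cvg _ cij covV).
(* [l / 2] allows for a covariance matrix that is only close to [V]; [2 + K] comes from
   [x ^ 4 <= 1 + |x| ^ (4 + delta)] for both coordinates. *)
pose C := 8 * (2 + K) / (l / 2) ^+ 2.
have moments n : (forall t, l / 2 * (1 + t ^+ 2) <=
      A n 0 0 - 2 * t * A n 0 1 + t ^+ 2 * A n 1 1) ->
    exists c C' sigma2, [/\ 0 < c, C' <= C,
      [/\ has_mean (PXY n) (fun z => c * (z.1 - EX n / EY n * z.2)) 0,
      has_mean (PXY n) (fun z => (c * (z.1 - EX n / EY n * z.2)) ^+ 2) 1 &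
      has_mean (PXY n) (fun z => (c * (z.1 - EX n / EY n * z.2)) ^+ 4) C'],
      has_mean (PXY n) (fun z => z.2 - EY n) 0 &
      has_mean (PXY n) (fun z => (z.2 - EY n) ^+ 2) sigma2 /\
      sigma2 = A n 1 1 / gY n ^+ 2].
  move=> A_le.
  pose F w := `|gX n * X n ord0 w| `^ (4 + delta) + `|gY n * Y n ord0 w| `^ (4 + delta).
  have mX : measurable_fun setT (X n ord0) by exact: (measurableT_comp measurable_fst).
  have mY : measurable_fun setT (Y n ord0) by exact: (measurableT_comp measurable_snd).
  have mpow (f : W n -> R) g : measurable_fun setT f ->
      measurable_fun setT (fun w => `|g * f w| `^ (4 + delta)).
    move=> mf; apply: (measurableT_comp (measurable_powR _)).
    by apply: measurableT_comp => //; exact: measurable_funM.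
  have EF : (\int[P n]_w (F w)%:E <= K%:E)%E by have := momK n; rewrite unlock.
  have [|||KF hF] := has_mean_ge0 (P := P n) (f := F).
  - by apply: measurable_funD; exact: mpow.
  - by move=> w; rewrite addr_ge0 ?powR_ge0.
  - by rewrite (le_lt_trans EF)// ltry.
  have KFK : KF <= K by rewrite -lee_fin -hF.2.
  pose q (z : R * R) := (gX n * z.1) ^+ 4 + (gY n * z.2) ^+ 4.
  have mq : measurable_fun setT q.
    by apply: measurable_funD; apply: measurable_funX; apply: measurable_funM.
  have hF2 := has_meanD (has_mean_cst (P n) 2) hF.
  have qF w : q (Z n ord0 w) <= 2 + F w.
    have := quartic_le_powR (gX n * X n ord0 w) delta0.
    have := quartic_le_powR (gY n * Y n ord0 w) delta0.
    by rewrite /q /F -/(X n ord0 w) -/(Y n ord0 w); lra.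
  have [||Kq hqP] := has_mean_dominated (f := fun w => q (Z n ord0 w)) _ hF2.
  - exact: measurableT_comp.
  - by move=> w; rewrite ger0_norm// addr_ge0// exprn_even_ge0.
  have KqK : Kq <= 2 + K.
    by apply: le_trans (has_mean_le hqP hF2 qF) _; rewrite lerD2l.
  have hq := has_mean_iid (Z_iid n) mq hqP.
  have [mx [my [vxx [vxy [vyy [hx hy hxx hxy hyy]]]]]] :=
    quartic_moments (gX0 n) (gY0 n) hq.
  have toP f m := @iid_has_mean _ _ _ _ _ _ _ _ _ (Z_iid n) f m ord0.
  have EXE : EX n = mx by rewrite /EX (has_mean_expectation (toP _ _ hx)).
  have EYE : EY n = my by rewrite /EY (has_mean_expectation (toP _ _ hy)).
  have hgX := has_meanZ (gX n) (toP _ _ hx).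
  have hgY := has_meanZ (gY n) (toP _ _ hy).
  have A00 : A n 0 0 = vxx.
    rewrite /A mxE; apply: (fine_covariance hgX hgX).
    by have := toP _ _ hxx; congr has_mean; apply/funext => w; rewrite expr2.
  have A01 : A n 0 1 = vxy.
    by rewrite /A mxE; apply: (fine_covariance hgX hgY); exact: toP hxy.
  have A11 : A n 1 1 = vyy.
    rewrite /A mxE; apply: (fine_covariance hgY hgY).
    by have := toP _ _ hyy; congr has_mean; apply/funext => w; rewrite expr2.
  have l20 : 0 < l / 2 by rewrite divr_gt0.
  have my0 : 0 < my by rewrite -EYE.
  rewrite A00 A01 A11 in A_le.
  have [c [C' [c0 C'le h1 h2 h4]]] :=
    standardized_contrast (gX0 n) (gY0 n) hq my0 hx hy hxx hxy hyy l20 A_le.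
  exists c, C', (vyy / gY n ^+ 2); rewrite EXE EYE A11; split => //.
  - apply: (le_trans C'le); rewrite /C ler_wpM2r ?invr_ge0 ?sqr_ge0//.
    by rewrite ler_wpM2l.
  - by have := has_meanD hy (has_mean_cst _ (- my)); rewrite subrr.
  - split=> //; have := has_meanZ (gY n ^- 2) hyy; congr has_mean; last exact: mulrC.
    by apply/funext => z; field; exact: lt0r_neq0 (gY0 n).
have K0 : 0 <= K.
  rewrite -lee_fin; apply: le_trans (momK 0); apply: expectation_ge0 => w.
  by rewrite addr_ge0 ?powR_ge0.
have C0 : 0 <= C.
  by rewrite /C divr_ge0 ?sqr_ge0// mulr_ge0// addr_ge0.
apply/fine_cvgP; split.
  apply: nearW => n; apply: fin_num_measure.
  by apply: measurable_percentile_interval => //; exact: measurable_sample.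
apply/cvgrPdist_le => e e0.
have /andP[a0 a1] := a01.
(* [kap] serves as smoothing width and as tolerance. The final error is at most [31 * kap] and the
   coverage bound asks for [10 * kap < alpha / 2] at worst, so 100 leaves room. *)
pose kap := Num.min (Num.min e alpha) 1 / 100.
have kap0 : 0 < kap.
  by rewrite divr_gt0// !lt_min e0 a0 ltr01.
have kape : kap * 100 <= e.
  by rewrite /kap divfK// !ge_min lexx.
have kapa : kap * 100 <= alpha.
  by rewrite /kap divfK// !ge_min lexx orbT.
have kap1 : kap * 100 <= 1.
  by rewrite /kap divfK// !ge_min lexx !orbT.
(* Majorizes the coefficient of [s] that the moment terms contribute to the final error, with [C]
   for the actual fourth moment and 1 for a remaining [s]. *)
pose M1 := 4 * (2 + C) / kap ^+ 3 + (C + 1) / kap ^+ 3 + 2 * (2 + 17 * C) / kap ^+ 4.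
have M10 : 0 <= M1.
  have i3 : 0 <= (kap ^+ 3)^-1 by rewrite invr_ge0 exprn_ge0 ?ltW.
  have i4 : 0 <= (kap ^+ 4)^-1 by rewrite invr_ge0 exprn_ge0 ?ltW.
  by rewrite /M1 !addr_ge0// mulr_ge0//; lra.
(* An error [l / 4] in each entry lowers the form by at most [l / 4 * (1 + |t|) ^ 2 <= l / 2 * (1 +
   t ^ 2)]; the tolerance [V 1 1] gives [0 <= A n 1 1 <= 2 * V 1 1]. *)
have tol0 : 0 < Num.min (l / 4) (V 1 1) by rewrite lt_min V11 divr_gt0.
near=> n.
have s_le : (Num.sqrt n.+1%:R)^-1 <= kap / (1 + M1).
  by near: n; apply: inv_sqrt_eventually; rewrite divr_gt0// ltr_pwDl.
have SNR_ge : 4 / kap <= SNR n.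
  by near: n; move/cvgryPge : SNRoo; exact.
have A00 : `|V 0 0 - A n 0 0| <= Num.min (l / 4) (V 1 1).
  by near: n; exact: cvgr_dist_le (Acvg 0 0) _ tol0.
have A01 : `|V 0 1 - A n 0 1| <= Num.min (l / 4) (V 1 1).
  by near: n; exact: cvgr_dist_le (Acvg 0 1) _ tol0.
have A11 : `|V 1 1 - A n 1 1| <= Num.min (l / 4) (V 1 1).
  by near: n; exact: cvgr_dist_le (Acvg 1 1) _ tol0.
move: A00 A01 A11; rewrite !le_min => /andP[A00 _] /andP[A01 _] /andP[A11 A11'].
move: A00 A01 A11 A11'; rewrite !ler_norml.
move=> /andP[_ A00] /andP[A01l A01u] /andP[_ A11] /andP[A11l A11u].
have [t|c [C' [sigma2 [c0 C'C [h1 h2 h4] hy1 [hy2 sigma2E]]]]] := moments n.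
  apply: le_trans (_ : l * (1 + t ^+ 2) - l / 4 * (1 + t ^+ 2 + (1 + t ^+ 2)) <= _).
    by rewrite le_eqVlt; apply/orP; left; apply/eqP; field.
  have cross : t * (A n 0 1 - V 0 1) <= l / 4 * (1 + t ^+ 2) / 2.
    apply: (@le_trans _ _ (l / 4 * `|t|)).
      rewrite (le_trans (ler_norm _))// normrM mulrC ler_wpM2r// ler_norml.
      by apply/andP; split; lra.
    have t_le : `|t| <= (1 + t ^+ 2) / 2.
      by rewrite -(real_normK (num_real t)); have := sqr_ge0 (`|t| - 1); nra.
    have l4 : 0 <= l / 4 by rewrite divr_ge0 ?(ltW l0).
    by have := ler_wpM2l l4 t_le; lra.
  have sq : t ^+ 2 * (V 1 1 - A n 1 1) <= t ^+ 2 * (l / 4) by rewrite ler_wpM2l ?sqr_ge0.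
  have := l_le t; lra.
have H := @percentile_interval_coverage _ _ _ _ _ _ _ _ _ _ _ _ _ _ _ (Z_iid n) (JS n)
  (ratioE n) (kT n) c0 (EY0 n) h1 h2 h4 hy1 hy2 alpha kap kap a01 kap0 kap0.
set s := (Num.sqrt n.+1%:R)^-1 in s_le H *.
have s0 : 0 < s by rewrite invr_gt0 sqrtr_gt0 ltr0n.
have sM1 : s + s * M1 <= kap.
  by move: s_le; rewrite ler_pdivlMr ?ltr_pwDl// mulrDr mulr1.
have sM0 : 0 <= s * M1 by rewrite mulr_ge0// ltW.
pose r := sigma2 / (n.+1%:R * EY n ^+ 2).
(* [r] is [A n 1 1 / V 1 1] divided by [SNR n ^ 2], hence at most [2 * (kap / 4) ^ 2]. *)
have r_le : r <= kap ^+ 2 / 8.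
  have g0 := gY0 n; have E0 := EY0 n.
  have V0 : Num.sqrt (V 1 1) != 0 by rewrite gt_eqF ?sqrtr_gt0.
  have S0 : Num.sqrt n.+1%:R != 0 :> R by rewrite gt_eqF ?sqrtr_gt0.
  have rE : r * SNR n ^+ 2 = A n 1 1 / V 1 1.
    have key (x y : R) : x != 0 -> y != 0 ->
        A n 1 1 / gY n ^+ 2 / (y ^+ 2 * EY n ^+ 2) *
        (EY n / (x * y^-1 * (gY n)^-1)) ^+ 2 = A n 1 1 / x ^+ 2.
      by move=> x0 y0; field; rewrite x0 y0 !gt_eqF.
    by have := key _ _ V0 S0; rewrite (sqr_sqrtr (ltW V11)) sqr_sqrtr// -sigma2E.
  have r0 : 0 <= r.
    rewrite /r sigma2E; apply: divr_ge0; last by rewrite mulr_ge0 ?sqr_ge0.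
    by apply: divr_ge0; [lra|exact: sqr_ge0].
  have r2 : r * SNR n ^+ 2 <= 2 by rewrite rE ler_pdivrMr//; lra.
  have SNR2 : (4 / kap) ^+ 2 <= SNR n ^+ 2.
    have p4 : 0 <= 4 / kap by rewrite divr_ge0 ?(ltW kap0).
    by rewrite ler_sqr ?nnegrE// (le_trans p4).
  have := le_trans (ler_wpM2l r0 SNR2) r2.
  rewrite expr_div_n mulrA ler_pdivrMr ?exprn_gt0//; lra.
rewrite -ler_norml distrC; apply: le_trans (H _) _ => {H}; first lra.
pose M := 4 * (2 + C') / kap ^+ 3 + (C' + s) / kap ^+ 3 + 2 * (2 + 17 * C') / kap ^+ 4.
have MM1 : M <= M1.
  have i3 : 0 <= (kap ^+ 3)^-1 by rewrite invr_ge0 exprn_ge0 ?ltW.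
  have i4 : 0 <= (kap ^+ 4)^-1 by rewrite invr_ge0 exprn_ge0 ?ltW.
  by rewrite /M /M1 !lerD// ler_wpM2r//; lra.
have sM : s * M <= s * M1 by rewrite ler_wpM2l// ltW.
have r_kap : r / kap <= kap / 8.
  by rewrite ler_pdivrMr// mulrAC -expr2.
apply: (@le_trans _ _ (21 * kap + 9 * s + s * M + 4 * (r / kap))); last lra.
rewrite -/r le_eqVlt; apply/orP; left; apply/eqP; rewrite /M; field.
exact: lt0r_neq0.
Unshelve. all: by end_near. Qed.
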